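(* For $b\in\mathbb{R}$ consider the degree $4$ polynomial $f:\mathbb{C}\to\mathbb{C}$ defined by $f(z):=z+z^2+bz^4$. There exists a parameter $b\in(-8/27,0)$ such that the Lavaurs map $\mathcal{L}_f$ has a fixed critical point in $\mathbb{R}\cap\mathcal{B}_f$, i.e. a point $c\in\mathbb{R}\cap\mathcal{B}_f$ with $\mathcal{L}_f(c)=c$ and $\mathcal{L}_f'(c)=0$.
   Context: The parabolic basin of $0$ is $\mathcal{B}_f:=\{z\in\mathbb{C}: f^{\circ n}(z)\to0 \text{ as } n\to+\infty,\ f^{\circ n}(z)\ne0 \text{ for all } n\}$. Let $\log$ be the branch of the logarithm on $\mathbb{C}\setminus\mathbb{R}^-$ vanishing at $1$. For $f(z)=z+z^2+az^3+O(z^4)$ (here $a=0$), the attracting Fatou coordinate is the holomorphic map $\phi_f:\mathcal{B}_f\to\mathbb{C}$ satisfying $\phi_f\circ f=\phi_f+1$, normalized by $\phi_f(z)=-\frac1z-(1-a)\log\left(-\frac1z\right)+o(1)$ as $\mathrm{Re}(-1/z)\to+\infty$. The repelling Fatou parameterization is the holomorphic map $\psi_f:\mathbb{C}\to\mathbb{C}$ satisfying $\psi_f(Z+1)=f(\psi_f(Z))$, normalized by $-\frac{1}{\psi_f(Z)}=Z+(1-a)\log(-Z)+o(1)$ as $\mathrm{Re}(Z)\to-\infty$. The (phase $0$) Lavaurs map is $\mathcal{L}_f:=\psi_f\circ\phi_f:\mathcal{B}_f\to\mathbb{C}$. *)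

(* Defs.v *)
From Stdlib Require Import Reals Lra.
From Coquelicot Require Import Coquelicot.
Open Scope C_scope.

Definition Cexp (z : C) : C := (exp (Re z) * cos (Im z), exp (Re z) * sin (Im z))%R.

Definition slit_plane (z : C) : Prop := (0 < Re z)%R \/ Im z <> 0%R.

(** By the half-angle formula, [2 atan (y / (|z| + x))] is the argument of
    [z = x + iy] in (-PI, PI); the value off [slit_plane] is irrelevant.
    [Clog_bound] and [Cexp_Clog] characterize this branch. *)
Definition Clog (z : C) : C :=
  (ln (Cmod z), 2 * atan (Im z / (Cmod z + Re z)))%R.

Lemma Clog_1 : Clog 1 = 0.
Proof.
unfold Clog; rewrite Cmod_1, ln_1; simpl.
replace (0 / (1 + 1))%R with 0%R by lra.
rewrite atan_0; apply injective_projections; simpl; ring.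
Qed.

Lemma Clog_bound (z : C) : (- PI < Im (Clog z) < PI)%R.
Proof.
unfold Clog; simpl; destruct (atan_bound (Im z / (Cmod z + Re z))); lra.
Qed.

Lemma Cexp_Clog (z : C) : slit_plane z -> Cexp (Clog z) = z.
Proof.
intros Hz; destruct z as [x y]; unfold slit_plane in Hz; unfold Cexp, Clog; simpl in *.
assert (Hm2 : (Cmod (x, y) * Cmod (x, y) = x * x + y * y)%R).
{ unfold Cmod; simpl; rewrite sqrt_sqrt; nra. }
pose proof (Cmod_ge_0 (x, y)) as Hm0.
set (m := Cmod (x, y)) in *; clearbody m.
assert (Hm : (0 < m)%R) by (destruct Hz; nra).
assert (Hs : (0 < m + x)%R).
{ destruct Hz as [Hx | Hy]; [lra |].
  assert (0 < y * y)%R by nra.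
  destruct (Rlt_le_dec 0 (m + x)); [lra | nra]. }
rewrite (exp_ln m Hm).
set (t := (y / (m + x))%R).
assert (Hy : (y = t * (m + x))%R) by (unfold t; field; lra).
assert (Hc : (0 < cos (atan t))%R) by (destruct (atan_bound t); apply cos_gt_0; lra).
pose proof (sin2_cos2 (atan t)) as Hsc; unfold Rsqr in Hsc.
assert (Ht : (sin (atan t) = t * cos (atan t))%R).
{ rewrite <- (tan_atan t) at 2; unfold tan; field; lra. }
rewrite cos_2a, sin_2a, Ht in *.
assert (Hc2 : ((1 + t * t) * (cos (atan t) * cos (atan t)) = 1)%R) by lra.
set (c := cos (atan t)) in *; clearbody c t.
assert (E : ((m - x) = t * t * (m + x))%R) by (subst y; nra).
assert (E2 : (2 * m = (1 + t * t) * (m + x))%R) by lra.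
apply injective_projections; simpl.
- replace (m * (c * c - t * c * (t * c)))%R
    with (2 * m * (c * c) - m * ((1 + t * t) * (c * c)))%R by ring.
  rewrite Hc2, E2.
  replace ((1 + t * t) * (m + x) * (c * c))%R
    with ((m + x) * ((1 + t * t) * (c * c)))%R by ring.
  rewrite Hc2; ring.
- replace (m * (2 * (t * c) * c))%R with (t * (2 * m) * (c * c))%R by ring.
  rewrite E2, Hy.
  replace (t * ((1 + t * t) * (m + x)) * (c * c))%R
    with (t * (m + x) * ((1 + t * t) * (c * c)))%R by ring.
  rewrite Hc2; ring.
Qed.

Definition parabolic_basin (f : C -> C) (z : C) : Prop :=
  filterlim (fun n : nat => Nat.iter n f z) eventually (locally (RtoC 0)) /\
  forall n : nat, Nat.iter n f z <> 0.

(** f(z) = z + z^2 + a z^3 + O(z^4) as z -> 0. *)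
Definition parabolic_expansion (f : C -> C) (a : C) : Prop :=
  exists M r : R, (0 < r)%R /\
    forall z : C, (Cmod z < r)%R ->
      (Cmod (f z - (z + z ^ 2 + a * z ^ 3)) <= M * Cmod z ^ 4)%R.

(** Maps defined on the basin are represented by total functions whose values
    elsewhere are ignored; the basin is open, so complex differentiability at
    its points does not depend on those values. *)
Definition attracting_fatou_coordinate (f : C -> C) (a : C) (phi : C -> C) : Prop :=
  (forall z : C, parabolic_basin f z -> ex_derive (V := C_NormedModule) phi z) /\
  (forall z : C, parabolic_basin f z -> phi (f z) = phi z + 1) /\
  (forall eps : R, (0 < eps)%R -> exists M : R,
     forall z : C, parabolic_basin f z -> (M < Re (- / z))%R ->
       (Cmod (phi z - (- / z - (1 - a) * Clog (- / z))) < eps)%R).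

(** The normalization forces [psi Z <> 0] when [Re Z] is very negative, so the
    convention [/ 0 = 0] plays no role. *)
Definition repelling_fatou_parameterization (f : C -> C) (a : C) (psi : C -> C) : Prop :=
  (forall Z : C, ex_derive (V := C_NormedModule) psi Z) /\
  (forall Z : C, psi (Z + 1) = f (psi Z)) /\
  (forall eps : R, (0 < eps)%R -> exists M : R,
     forall Z : C, (Re Z < M)%R ->
       (Cmod (- / psi Z - (Z + (1 - a) * Clog (- Z))) < eps)%R).

(** The coefficient [a], the coordinate [phi] on the basin and [psi] are all
    determined by [f], hence so is [L] on the basin. *)
Definition lavaurs_map (f : C -> C) (L : C -> C) : Prop :=
  exists (a : C) (phi psi : C -> C),
    parabolic_expansion f a /\
    attracting_fatou_coordinate f a phi /\
    repelling_fatou_parameterization f a psi /\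
    forall z : C, parabolic_basin f z -> L z = psi (phi z).

Definition quartic (b : R) (z : C) : C := z + z ^ 2 + b * z ^ 4.

(* Main.v *)
Require Import Defs.
From Stdlib Require Import Reals Lra Lia ClassicalEpsilon.
From Coquelicot Require Import Coquelicot.
Local Open Scope R_scope.

(** Write [f] for [quartic b]; here [a = 0].  The change of coordinate [w = - 1 / z] turns
    [f] into a map [F w = w + 1 + 1 / w + O(1 / w^2)] fixing infinity, and everything is
    done there.

    The attracting coordinate is the limit of [F^n w - n - log (F^n w)]: since
    [w - log w] satisfies the Abel equation of [F] up to [O(1 / w^2)], the increments are
    summable along orbits ([approximate_abel]).  The repelling parameterization is the
    limit of [F^n (model (Z - n))] with [model Z = Z + log (- Z)], because [F (model Z)]
    and [model (Z + 1)] differ by a summable amount ([model_step]) and [F^n] distorts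
    distances by a bounded factor ([iter_distortion]).  Both limits are holomorphic by
    [cderiv_limit]: the second-order remainders of the approximations are bounded
    uniformly in [n], again by [iter_distortion].

    For the fixed critical point, parameterize the family by the positive critical point
    [c] of [f], with [c] in [[3/2, 33/20]]; then [b = - (1 + 2 c) / (4 c^3)] starts at
    [- 8 / 27].  The second image [f (f c)] is negative and lies in the basin, so [c] does
    too, and [phi c] is real.  On the other side [c] has a real backward orbit tending to
    [0] from the right, so [c = psi x] for a real phase [x].  Whenever [phi c = x] one gets
    [psi (phi c) = c], and [phi' c = 0] because [phi = phi o f - 1] and [f' c = 0].

    The equation [phi c = x] is solved by the intermediate value theorem
    ([matching_parameter]).  Both [phi c] and [x] are uniform limits, in [c], of explicit
    continuous functions: with [log_coordinate z = - 1 / z + log |z|] the error committed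
    by stopping at an orbit point [z] is [O(|z|)], as the defects of the Abel equation
    telescope against the displacements [f z - z].  The same telescoping gives numerical
    bounds showing that [phi c - x] is positive at [c = 3 / 2] and negative at
    [c = 33 / 20]. *)

(** * Complex derivatives and limits in epsilon-delta form *)

Definition cderiv (f : C -> C) (z l : C) : Prop :=
  forall eps, 0 < eps -> exists d, 0 < d /\ forall h : C, Cmod h < d ->
    Cmod (f (z + h) - f z - l * h)%C <= eps * Cmod h.

Lemma is_derive_cderiv (f : C -> C) (z l : C) :
  is_derive (K := C_AbsRing) (V := C_NormedModule) f z l <-> cderiv f z l.
Proof.
split.
- intros [_ H] eps He.
  destruct (H z (fun P HP => HP) (mkposreal eps He)) as [d Hd].
  exists d; split; [apply cond_pos |]; intros h Hh.
  assert (E : (z + h - z = h)%C) by ring.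
  specialize (Hd (z + h)%C).
  assert (B : ball (M := AbsRing_UniformSpace C_AbsRing) z d (z + h)%C).
  { change (Cmod (z + h - z)%C < d); now rewrite E. }
  specialize (Hd B).
  change (Cmod (f (z + h) - f z - (z + h - z) * l)%C <= eps * Cmod (z + h - z)%C) in Hd.
  now rewrite E, (Cmult_comm h l) in Hd.
- intros H; split.
  + apply (is_linear_scal_l (K := C_AbsRing) (V := C_NormedModule)).
  + intros x Hx.
    apply (is_filter_lim_locally_unique (V := AbsRing_NormedModule C_AbsRing)) in Hx.
    subst x; intros eps.
    destruct (H eps (cond_pos eps)) as (d & Hd & Hh).
    exists (mkposreal d Hd); intros y Hy.
    change (Cmod (y - z)%C < d) in Hy.
    change (Cmod (f y - f z - (y - z) * l)%C <= eps * Cmod (y - z)%C).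
    specialize (Hh (y - z)%C Hy).
    assert (E : forall a b : C, (a + (b - a))%C = b) by (intros; ring).
    rewrite (E z y) in Hh.
    now rewrite (Cmult_comm (y - z)%C l).
Qed.

Lemma Cmod_sub_sym (z w : C) : Cmod (z - w)%C = Cmod (w - z)%C.
Proof. rewrite <- Cmod_opp; f_equal; ring. Qed.

Lemma Cmod_sub_triangle (z w : C) : Cmod z - Cmod w <= Cmod (z - w)%C.
Proof.
pose proof (Cmod_triangle (z - w)%C w) as H.
replace (z - w + w)%C with z in H by ring; lra.
Qed.

Lemma Cmod_sub_le (z w : C) : Cmod (z - w)%C <= Cmod z + Cmod w.
Proof. unfold Cminus; rewrite <- (Cmod_opp w); apply Cmod_triangle. Qed.

Lemma im_le_Cmod (z : C) : Rabs (Im z) <= Cmod z.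
Proof. eapply Rle_trans; [apply Rmax_r | apply Rmax_Cmod]. Qed.

Lemma Re_le_Cmod (z : C) : Re z <= Cmod z.
Proof. eapply Rle_trans; [apply Rle_abs | apply re_le_Cmod]. Qed.

Lemma Re_ge_Cmod (z : C) : - Cmod z <= Re z.
Proof. pose proof (re_le_Cmod z) as H; apply Rabs_le_between in H; lra. Qed.

Lemma Cmod_le_Re_Im (z : C) : Cmod z <= Rabs (Re z) + Rabs (Im z).
Proof.
replace z with (RtoC (Re z) + Ci * RtoC (Im z))%C at 1.
- eapply Rle_trans; [apply Cmod_triangle |].
  rewrite Cmod_mult, Cmod_Ci, !Cmod_R; lra.
- destruct z as [x y]; apply injective_projections; simpl; ring.
Qed.

Lemma Cinv_0 : (/ RtoC 0)%C = RtoC 0.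
Proof. apply injective_projections; simpl; unfold Rdiv; ring. Qed.

Lemma Cinv_involutive (z : C) : (/ / z)%C = z.
Proof.
destruct (Ceq_dec z 0) as [-> | H]; [now rewrite !Cinv_0 |].
field; auto.
Qed.

Lemma Copp_inv (z : C) : (/ (- z))%C = (- / z)%C.
Proof.
destruct (Ceq_dec z 0) as [-> | H].
- replace (- RtoC 0)%C with (RtoC 0) by ring; rewrite Cinv_0; ring.
- field; auto.
Qed.

Lemma cderiv_ext_loc f g z l r : 0 < r ->
  (forall h : C, Cmod h < r -> f (z + h)%C = g (z + h)%C) ->
  cderiv f z l -> cderiv g z l.
Proof.
intros Hr E H eps He; destruct (H eps He) as (d & Hd & Hh).
exists (Rmin r d); split; [now apply Rmin_glb_lt |].
intros h Hhd.
assert (E0 : f z = g z).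
{ specialize (E 0%C); rewrite Cmod_0 in E.
  replace (z + 0)%C with z in E by ring; auto. }
rewrite <- E, <- E0; [apply Hh |]; eapply Rlt_le_trans; eauto;
  [apply Rmin_r | apply Rmin_l].
Qed.

Lemma cderiv_of_quadratic f z l K r : 0 < r ->
  (forall h : C, Cmod h < r -> Cmod (f (z + h) - f z - l * h)%C <= K * Cmod h ^ 2) ->
  cderiv f z l.
Proof.
intros Hr H eps He.
assert (HK : 0 < Rabs K + 1) by (pose proof (Rabs_pos K); lra).
exists (Rmin r (eps / (Rabs K + 1))); split.
- apply Rmin_glb_lt; auto; now apply Rdiv_lt_0_compat.
- intros h Hh.
  eapply Rle_trans; [apply H; eapply Rlt_le_trans; [apply Hh | apply Rmin_l] |].
  pose proof (Cmod_ge_0 h) as H0; pose proof (Rle_abs K) as HRK.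
  assert (H1 : Cmod h <= eps / (Rabs K + 1)).
  { apply Rlt_le; eapply Rlt_le_trans; [apply Hh | apply Rmin_r]. }
  assert (H2 : (Rabs K + 1) * Cmod h <= eps).
  { replace eps with ((Rabs K + 1) * (eps / (Rabs K + 1))) by (field; lra).
    apply Rmult_le_compat_l; lra. }
  assert (H3 : (K * Cmod h) * Cmod h <= eps * Cmod h).
  { apply Rmult_le_compat_r; auto; nra. }
  simpl; nra.
Qed.

Lemma cderiv_lipschitz f z l : cderiv f z l ->
  exists d, 0 < d /\ forall h : C, Cmod h < d ->
    Cmod (f (z + h) - f z)%C <= (Cmod l + 1) * Cmod h.
Proof.
intros H; destruct (H 1 Rlt_0_1) as (d & Hd & Hh).
exists d; split; auto; intros h Hhd; specialize (Hh h Hhd).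
replace (f (z + h) - f z)%C with (f (z + h) - f z - l * h + l * h)%C by ring.
eapply Rle_trans; [apply Cmod_triangle |]; rewrite Cmod_mult; lra.
Qed.

Lemma cderiv_continuous f z l : cderiv f z l ->
  forall eps, 0 < eps -> exists d, 0 < d /\ forall h : C, Cmod h < d ->
    Cmod (f (z + h) - f z)%C < eps.
Proof.
intros H eps He; destruct (cderiv_lipschitz f z l H) as (d & Hd & Hh).
pose proof (Cmod_ge_0 l) as Hl.
exists (Rmin d (eps / (Cmod l + 1))); split.
- apply Rmin_glb_lt; auto; apply Rdiv_lt_0_compat; lra.
- intros h H1; eapply Rle_lt_trans.
  + apply Hh; eapply Rlt_le_trans; [apply H1 | apply Rmin_l].
  + replace eps with ((Cmod l + 1) * (eps / (Cmod l + 1))) by (field; lra).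
    apply Rmult_lt_compat_l; [lra |].
    eapply Rlt_le_trans; [apply H1 | apply Rmin_r].
Qed.

Lemma cderiv_comp f g z l m :
  cderiv g z l -> cderiv f (g z) m -> cderiv (fun x => f (g x)) z (m * l)%C.
Proof.
intros Hg Hf eps He.
pose proof (Cmod_ge_0 l) as Hl; pose proof (Cmod_ge_0 m) as Hm.
destruct (cderiv_lipschitz g z l Hg) as (d1 & Hd1 & L).
destruct (Hf (eps / (2 * (Cmod l + 1)))) as (d2 & Hd2 & A);
  [apply Rdiv_lt_0_compat; lra |].
destruct (cderiv_continuous g z l Hg d2 Hd2) as (d3 & Hd3 & B).
destruct (Hg (eps / (2 * (Cmod m + 1)))) as (d4 & Hd4 & D);
  [apply Rdiv_lt_0_compat; lra |].
exists (Rmin (Rmin d1 d3) d4); split; [repeat apply Rmin_glb_lt; auto |].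
intros h Hh.
assert (h1 : Cmod h < d1 /\ Cmod h < d3 /\ Cmod h < d4).
{ pose proof (Rmin_l (Rmin d1 d3) d4); pose proof (Rmin_r (Rmin d1 d3) d4).
  pose proof (Rmin_l d1 d3); pose proof (Rmin_r d1 d3); lra. }
destruct h1 as (h1 & h3 & h4).
specialize (L h h1); specialize (B h h3); specialize (D h h4).
specialize (A (g (z + h) - g z)%C B).
replace (g z + (g (z + h)%C - g z))%C with (g (z + h)%C) in A by ring.
replace (f (g (z + h)%C) - f (g z) - m * l * h)%C with
  ((f (g (z + h)%C) - f (g z) - m * (g (z + h)%C - g z)) +
   m * (g (z + h)%C - g z - l * h))%C by ring.
eapply Rle_trans; [apply Cmod_triangle |]; rewrite Cmod_mult.
assert (X1 : eps / (2 * (Cmod l + 1)) * Cmod (g (z + h) - g z)%C <= eps / 2 * Cmod h).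
{ replace (eps / 2 * Cmod h) with
    (eps / (2 * (Cmod l + 1)) * ((Cmod l + 1) * Cmod h)) by (field; lra).
  apply Rmult_le_compat_l; auto; apply Rlt_le, Rdiv_lt_0_compat; lra. }
assert (X2 : Cmod m * Cmod (g (z + h) - g z - l * h)%C <= eps / 2 * Cmod h).
{ apply Rle_trans with ((Cmod m + 1) * (eps / (2 * (Cmod m + 1)) * Cmod h)).
  - apply Rmult_le_compat; try apply Cmod_ge_0; lra.
  - right; field; lra. }
lra.
Qed.

Lemma cderiv_add_const f z l k : cderiv f z l -> cderiv (fun x => f x + k)%C z l.
Proof.
intros H eps He; destruct (H eps He) as (d & Hd & Hh); exists d; split; auto.
intros h Hhd; replace (f (z + h) + k - (f z + k) - l * h)%C
  with (f (z + h) - f z - l * h)%C by ring; auto.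
Qed.

Lemma cderiv_translate k z : cderiv (fun x => x + k)%C z 1.
Proof.
apply (cderiv_of_quadratic _ _ _ 0 1 Rlt_0_1); intros h _.
replace (z + h + k - (z + k) - 1 * h)%C with (RtoC 0) by ring.
rewrite Cmod_0; lra.
Qed.

Lemma cderiv_opp_inv (z : C) : z <> 0%C -> cderiv (fun x => - / x)%C z (/ (z * z))%C.
Proof.
intros Hz; assert (P : 0 < Cmod z) by now apply Cmod_gt_0.
apply (cderiv_of_quadratic _ _ _ (2 / Cmod z ^ 3) (Cmod z / 2)); [lra |].
intros h Hh.
assert (Q : Cmod z / 2 <= Cmod (z + h)%C).
{ pose proof (Cmod_sub_triangle z (- h)%C) as T; rewrite Cmod_opp in T.
  replace (z - - h)%C with (z + h)%C in T by ring; lra. }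
assert (Hzh : (z + h)%C <> 0%C) by (apply Cmod_gt_0; lra).
replace (- / (z + h) - - / z - / (z * z) * h)%C with (- (h * h) / (z * z * (z + h)))%C
  by (field; auto).
rewrite Cmod_div by (repeat apply Cmult_neq_0; auto).
rewrite Cmod_opp, !Cmod_mult.
replace (2 / Cmod z ^ 3 * Cmod h ^ 2)
  with ((Cmod h * Cmod h) * / (Cmod z * Cmod z * (Cmod z / 2))) by (field; lra).
unfold Rdiv; apply Rmult_le_compat_l; [apply Rmult_le_pos; apply Cmod_ge_0 |].
assert (Z2 : 0 < Cmod z * Cmod z) by now apply Rmult_lt_0_compat.
apply Rinv_le_contravar; [apply Rmult_lt_0_compat | apply Rmult_le_compat_l]; lra.
Qed.

Definition cconv (u : nat -> C) (l : C) : Prop :=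
  forall eps, 0 < eps -> exists N, forall n, (N <= n)%nat -> Cmod (u n - l)%C < eps.

Definition Clim (u : nat -> C) : C := epsilon (inhabits (RtoC 0)) (cconv u).

Lemma cconv_unique u l m : cconv u l -> cconv u m -> l = m.
Proof.
intros Hl Hm.
destruct (Ceq_dec l m) as [E | E]; auto; exfalso.
assert (P : 0 < Cmod (l - m)%C).
{ apply Cmod_gt_0; intro F; apply E; replace l with (l - m + m)%C by ring; rewrite F; ring. }
destruct (Hl (Cmod (l - m)%C / 2)) as [N1 H1]; [lra |].
destruct (Hm (Cmod (l - m)%C / 2)) as [N2 H2]; [lra |].
specialize (H1 (N1 + N2)%nat ltac:(lia)); specialize (H2 (N1 + N2)%nat ltac:(lia)).
pose proof (Cmod_triangle (l - u (N1 + N2)%nat)%C (u (N1 + N2)%nat - m)%C) as T.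
replace (l - u (N1 + N2)%nat + (u (N1 + N2)%nat - m))%C with (l - m)%C in T by ring.
rewrite (Cmod_sub_sym l (u _)) in T; lra.
Qed.

Lemma Clim_eq u l : cconv u l -> Clim u = l.
Proof.
intros H; apply (cconv_unique u); auto.
unfold Clim; apply epsilon_spec; now exists l.
Qed.

Lemma Clim_cconv u : (exists l, cconv u l) -> cconv u (Clim u).
Proof. intros [l H]; now rewrite (Clim_eq u l H). Qed.

Lemma cconv_cauchy (u : nat -> C) :
  (forall eps, 0 < eps -> exists N, forall n m, (N <= n)%nat -> (N <= m)%nat ->
     Cmod (u n - u m)%C < eps) ->
  exists l, cconv u l.
Proof.
intros H.
assert (Hre : Cauchy_crit (fun n => Re (u n))).
{ intros eps He; destruct (H eps He) as [N HN]; exists N; intros n m Hn Hm.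
  unfold Rdist; eapply Rle_lt_trans; [| apply (HN n m); lia].
  exact (re_le_Cmod (u n - u m)%C). }
assert (Him : Cauchy_crit (fun n => Im (u n))).
{ intros eps He; destruct (H eps He) as [N HN]; exists N; intros n m Hn Hm.
  unfold Rdist; eapply Rle_lt_trans; [| apply (HN n m); lia].
  exact (im_le_Cmod (u n - u m)%C). }
destruct (Rcomplete.R_complete _ Hre) as [x Hx]; destruct (Rcomplete.R_complete _ Him) as [y Hy].
exists (x, y); intros eps He.
destruct (Hx (eps / 2)) as [N1 H1]; [lra |]; destruct (Hy (eps / 2)) as [N2 H2]; [lra |].
exists (N1 + N2)%nat; intros n Hn.
specialize (H1 n ltac:(lia)); specialize (H2 n ltac:(lia)); unfold Rdist in H1, H2.
eapply Rle_lt_trans; [apply Cmod_le_Re_Im |].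
change (Rabs (Re (u n) - x) + Rabs (Im (u n) - y) < eps); lra.
Qed.

Lemma cconv_le (u : nat -> C) l k e :
  (exists N, forall n, (N <= n)%nat -> Cmod (u n - k)%C <= e) -> cconv u l ->
  Cmod (l - k)%C <= e.
Proof.
intros [N HN] H; apply Rnot_lt_le; intros Hlt.
destruct (H (Cmod (l - k)%C - e)) as [N2 H2]; [lra |].
specialize (HN (N + N2)%nat ltac:(lia)); specialize (H2 (N + N2)%nat ltac:(lia)).
pose proof (Cmod_triangle (l - u (N + N2)%nat)%C (u (N + N2)%nat - k)%C) as T.
replace (l - u (N + N2)%nat + (u (N + N2)%nat - k))%C with (l - k)%C in T by ring.
rewrite (Cmod_sub_sym l (u _)) in T; lra.
Qed.

Lemma cconv_ext u v l : (exists N, forall n, (N <= n)%nat -> u n = v n) ->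
  cconv u l -> cconv v l.
Proof.
intros [N E] H eps He; destruct (H eps He) as [N2 H2].
exists (N + N2)%nat; intros n Hn; rewrite <- E by lia; apply H2; lia.
Qed.

Lemma cconv_shift u l k : cconv (fun n => u (n + k)%nat) l -> cconv u l.
Proof.
intros H eps He; destruct (H eps He) as [N HN]; exists (N + k)%nat; intros n Hn.
specialize (HN (n - k)%nat ltac:(lia)); now replace (n - k + k)%nat with n in HN by lia.
Qed.

Lemma cconv_unshift u l k : cconv u l -> cconv (fun n => u (n + k)%nat) l.
Proof.
intros H eps He; destruct (H eps He) as [N HN]; exists N; intros n Hn; apply HN; lia.
Qed.

Lemma cconv_add_const u l k : cconv u l -> cconv (fun n => u n + k)%C (l + k)%C.
Proof.
intros H eps He; destruct (H eps He) as [N HN]; exists N; intros n Hn.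
replace (u n + k - (l + k))%C with (u n - l)%C by ring; auto.
Qed.

Lemma cconv_sub u v l m : cconv u l -> cconv v m -> cconv (fun n => u n - v n)%C (l - m)%C.
Proof.
intros H K eps He; destruct (H (eps / 2)) as [N HN]; [lra |].
destruct (K (eps / 2)) as [M HM]; [lra |].
exists (N + M)%nat; intros n Hn.
specialize (HN n ltac:(lia)); specialize (HM n ltac:(lia)).
replace (u n - v n - (l - m))%C with ((u n - l) - (v n - m))%C by ring.
eapply Rle_lt_trans; [apply Cmod_sub_le | lra].
Qed.

Lemma cconv_map f l d u : cderiv f l d -> cconv u l -> cconv (fun n => f (u n)) (f l).
Proof.
intros D H eps He; destruct (cderiv_continuous f l d D eps He) as (r & Hr & K).
destruct (H r Hr) as [N HN]; exists N; intros n Hn.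
specialize (K (u n - l)%C (HN n Hn)).
now replace (l + (u n - l))%C with (u n) in K by ring.
Qed.

(** A pointwise limit inherits differentiability from a second-order bound that is
    uniform along the sequence: subtracting the bound at two indices shows that the
    approximate derivatives are themselves Cauchy.  This replaces the usual appeal to
    Cauchy's integral formula for limits of holomorphic functions. *)
Lemma cderiv_limit (g : nat -> C -> C) (G : C -> C) (p : nat -> C) (z : C) (K r : R) :
  0 < r ->
  (forall h : C, Cmod h < r -> cconv (fun n => g n (z + h)%C) (G (z + h)%C)) ->
  (forall n (h : C), Cmod h < r ->
     Cmod (g n (z + h) - g n z - p n * h)%C <= K * Cmod h ^ 2) ->
  exists l, cderiv G z l.
Proof.
intros Hr Hlim Hq.
assert (Hz : cconv (fun n => g n z) (G z)).
{ specialize (Hlim 0%C); rewrite Cmod_0 in Hlim.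
  replace (z + 0)%C with z in Hlim by ring; auto. }
assert (HK : 0 <= K).
{ pose proof (Hq 0%nat (RtoC (r / 2))) as H; rewrite Cmod_R, Rabs_pos_eq in H by lra.
  specialize (H ltac:(lra)).
  pose proof (Cmod_ge_0 (g 0%nat (z + RtoC (r / 2)) - g 0%nat z - p 0%nat * RtoC (r / 2))%C).
  assert (0 < (r / 2) ^ 2) by (apply pow_lt; lra).
  apply Rnot_lt_le; intro; nra. }
assert (Hp : exists l, cconv p l).
{ apply cconv_cauchy; intros eps He.
  (* evaluation at a step [t] with [2 K t] below [eps / 2] *)
  set (t := Rmin (r / 2) (eps / (4 * (K + 1)))).
  assert (t0 : 0 < t) by (apply Rmin_glb_lt; [lra | apply Rdiv_lt_0_compat; lra]).
  assert (tr : t < r) by (pose proof (Rmin_l (r / 2) (eps / (4 * (K + 1)))); unfold t; lra).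
  assert (tK : 2 * K * t <= eps / 2).
  { pose proof (Rmin_r (r / 2) (eps / (4 * (K + 1)))) as H; fold t in H.
    apply Rle_trans with (2 * (K + 1) * (eps / (4 * (K + 1)))); [nra |].
    right; field; lra. }
  assert (Ht : Cmod (RtoC t) = t) by (rewrite Cmod_R, Rabs_pos_eq; lra).
  pose proof (cconv_sub _ _ _ _ (Hlim (RtoC t) ltac:(lra)) Hz) as HD; simpl in HD.
  destruct (HD (eps * t / 4)) as [N HN]; [nra |].
  exists N; intros n m Hn Hm.
  pose proof (HN n Hn) as A; pose proof (HN m Hm) as B.
  pose proof (Hq n (RtoC t) ltac:(lra)) as U; pose proof (Hq m (RtoC t) ltac:(lra)) as V.
  rewrite Ht in U, V.
  set (dn := (g n (z + RtoC t) - g n z)%C) in *.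
  set (dm := (g m (z + RtoC t) - g m z)%C) in *.
  set (L := (G (z + RtoC t) - G z)%C) in *.
  assert (T : Cmod ((p n - p m) * RtoC t)%C < eps * t).
  { replace ((p n - p m) * RtoC t)%C with
      (((dn - L) - (dm - L)) - ((dn - p n * RtoC t) - (dm - p m * RtoC t)))%C by ring.
    eapply Rle_lt_trans; [apply Cmod_sub_le |].
    pose proof (Cmod_sub_le (dn - L)%C (dm - L)%C).
    pose proof (Cmod_sub_le (dn - p n * RtoC t)%C (dm - p m * RtoC t)%C).
    simpl in U, V; nra. }
  rewrite Cmod_mult, Ht in T; apply Rmult_lt_reg_r with t; lra. }
destruct Hp as [l Hl]; exists l.
apply (cderiv_of_quadratic _ _ _ K r Hr); intros h Hh.
replace (G (z + h) - G z - l * h)%C with (G (z + h) - G z - l * h - 0)%C by ring.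
apply cconv_le with (fun n => g n (z + h)%C - g n z - p n * h)%C.
- exists 0%nat; intros n _; replace (g n (z + h) - g n z - p n * h - 0)%C
    with (g n (z + h) - g n z - p n * h)%C by ring; auto.
- apply cconv_sub; [apply cconv_sub; auto |].
  refine (cconv_map (fun x => x * h)%C l h p _ Hl).
  apply (cderiv_of_quadratic _ _ _ 0 1 Rlt_0_1); intros k _.
  replace ((l + k) * h - l * h - h * k)%C with (RtoC 0) by ring; rewrite Cmod_0; lra.
Qed.

(** * The logarithm on the right half-plane *)

Lemma is_derive_ln_modulus (x y u v t : R) : 0 < x + t * u ->
  is_derive (fun t => ln (sqrt ((x + t * u) ^ 2 + (y + t * v) ^ 2))) t
    (((x + t * u) * u + (y + t * v) * v) / ((x + t * u) ^ 2 + (y + t * v) ^ 2)).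
Proof.
intros Hx.
assert (P : 0 < (x + t * u) ^ 2 + (y + t * v) ^ 2)
  by (pose proof (pow_lt _ 2 Hx); pose proof (pow2_ge_0 (y + t * v)); lra).
assert (Q : 0 < sqrt ((x + t * u) ^ 2 + (y + t * v) ^ 2)) by now apply sqrt_lt_R0.
assert (S : sqrt ((x + t * u) ^ 2 + (y + t * v) ^ 2) ^ 2 =
            (x + t * u) ^ 2 + (y + t * v) ^ 2) by (apply pow2_sqrt; lra).
auto_derive.
- simpl in *; repeat split; auto.
- set (X := x + t * u) in *; set (Y := y + t * v) in *.
  change (X * (X * 1)) with (X ^ 2); change (Y * (Y * 1)) with (Y ^ 2).
  rewrite <- S; set (q := sqrt (X ^ 2 + Y ^ 2)) in *.
  replace (sqrt (q ^ 2)) with q by (rewrite sqrt_pow2; lra).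
  clearbody q; field; lra.
Qed.

Lemma is_derive_argument (x y u v t : R) : 0 < x + t * u ->
  is_derive (fun t => 2 * atan ((y + t * v) /
      (sqrt ((x + t * u) ^ 2 + (y + t * v) ^ 2) + (x + t * u)))) t
    (((x + t * u) * v - (y + t * v) * u) / ((x + t * u) ^ 2 + (y + t * v) ^ 2)).
Proof.
intros Hx.
assert (P : 0 < (x + t * u) ^ 2 + (y + t * v) ^ 2)
  by (pose proof (pow_lt _ 2 Hx); pose proof (pow2_ge_0 (y + t * v)); lra).
assert (Q : 0 < sqrt ((x + t * u) ^ 2 + (y + t * v) ^ 2)) by now apply sqrt_lt_R0.
assert (S : sqrt ((x + t * u) ^ 2 + (y + t * v) ^ 2) ^ 2 =
            (x + t * u) ^ 2 + (y + t * v) ^ 2) by (apply pow2_sqrt; lra).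
auto_derive.
- simpl in *; repeat split; auto; lra.
- set (X := x + t * u) in *; set (Y := y + t * v) in *.
  change (X * (X * 1)) with (X ^ 2); change (Y * (Y * 1)) with (Y ^ 2).
  set (q := sqrt (X ^ 2 + Y ^ 2)) in *.
  rewrite <- S; clearbody q.
  assert (D : 1 + Y * / (q + X) * (Y * / (q + X) * 1) = 2 * q / (q + X)).
  { replace (1 + Y * / (q + X) * (Y * / (q + X) * 1))
      with (((q + X) ^ 2 + Y ^ 2) / (q + X) ^ 2) by (field; lra).
    replace (Y ^ 2) with (q ^ 2 - X ^ 2) by lra; field; lra. }
  rewrite D.
  transitivity ((v * (q ^ 2 - Y ^ 2) + v * q * X - u * X * Y - u * Y * q) /
                (q ^ 2 * (q + X))); [field; lra |].
  replace (q ^ 2 - Y ^ 2) with (X ^ 2) by lra; field; lra.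
Qed.

Lemma is_derive_linear (k t : R) : is_derive (fun t => t * k) t k.
Proof. auto_derive; auto; ring. Qed.

Lemma Re_div_pair (u v x y : R) : 0 < x ->
  Re ((u, v) / (x, y))%C = (u * x + v * y) / (x ^ 2 + y ^ 2).
Proof.
intros Hx; pose proof (pow_lt _ 2 Hx); pose proof (pow2_ge_0 y).
simpl in *; field; lra.
Qed.

Lemma Im_div_pair (u v x y : R) : 0 < x ->
  Im ((u, v) / (x, y))%C = (x * v - y * u) / (x ^ 2 + y ^ 2).
Proof.
intros Hx; pose proof (pow_lt _ 2 Hx); pose proof (pow2_ge_0 y).
simpl in *; field; lra.
Qed.

Lemma mean_value_bound (f : R -> R) (df : R -> R) (k : R) :
  (forall t, 0 <= t <= 1 -> is_derive f t (df t)) ->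
  (forall t, 0 <= t <= 1 -> Rabs (df t) <= k) -> Rabs (f 1 - f 0) <= k.
Proof.
intros H B.
destruct (MVT_gen f 0 1 df) as (c & Hc & E).
- intros t Ht; rewrite Rmin_left, Rmax_right in Ht by lra; apply H; lra.
- intros t Ht; rewrite Rmin_left, Rmax_right in Ht by lra.
  apply continuity_pt_filterlim, (ex_derive_continuous (V := R_NormedModule)).
  exists (df t); apply H; lra.
- rewrite Rmin_left, Rmax_right in Hc by lra.
  rewrite E; replace (df c * (1 - 0)) with (df c) by ring; auto.
Qed.

(** Along the segment from [z] to [z + u] the derivative of the logarithm differs
    from [u / z] by at most [2 |u|^2 / |z|^2]; the mean value theorem is applied to
    the modulus and to the argument separately. *)
Lemma Clog_expansion (z u : C) : 0 < Re z -> 0 < Re (z + u)%C -> 2 * Cmod u <= Cmod z ->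
  Cmod (Clog (z + u) - Clog z - u / z)%C <= 4 * Cmod u ^ 2 / Cmod z ^ 2.
Proof.
destruct z as [x y]; destruct u as [u v]; intros Hz Hzu Hu.
set (z := (x, y) : C) in *; set (w := (u, v) : C) in *.
assert (Pz : 0 < Cmod z) by (pose proof (Re_le_Cmod z); lra).
assert (Nz : z <> 0%C) by now apply Cmod_gt_0.
change (0 < x) in Hz; change (0 < x + u) in Hzu.
assert (Pt : forall t, 0 <= t <= 1 -> 0 < x + t * u) by (intros t Ht; destruct (Rle_lt_dec u 0); nra).
assert (Path : forall t, (z + RtoC t * w)%C = (x + t * u, y + t * v)).
{ intros t; apply injective_projections; simpl; ring. }
set (df := fun t : R => (w / (z + RtoC t * w) - w / z)%C).
assert (B : forall t, 0 <= t <= 1 -> Cmod (df t) <= 2 * Cmod w ^ 2 / Cmod z ^ 2).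
{ intros t Ht; unfold df.
  assert (G : Cmod z / 2 <= Cmod (z + RtoC t * w)%C).
  { pose proof (Cmod_sub_triangle z (- (RtoC t * w))%C) as T; rewrite Cmod_opp in T.
    replace (z - - (RtoC t * w))%C with (z + RtoC t * w)%C in T by ring.
    rewrite Cmod_mult, Cmod_R, Rabs_pos_eq in T by lra.
    pose proof (Cmod_ge_0 w); nra. }
  assert (Ng : (z + RtoC t * w)%C <> 0%C) by (apply Cmod_gt_0; lra).
  replace (w / (z + RtoC t * w) - w / z)%C
    with (- (RtoC t * (w * w)) / ((z + RtoC t * w) * z))%C by (field; auto).
  rewrite Cmod_div by (apply Cmult_neq_0; auto).
  rewrite Cmod_opp, !Cmod_mult, Cmod_R, Rabs_pos_eq by lra.
  replace (2 * Cmod w ^ 2 / Cmod z ^ 2)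
    with ((Cmod w * Cmod w) * / (Cmod z / 2 * Cmod z)) by (field; lra).
  pose proof (Cmod_ge_0 w).
  apply Rmult_le_compat.
  - apply Rmult_le_pos; nra.
  - left; apply Rinv_0_lt_compat, Rmult_lt_0_compat; lra.
  - rewrite <- (Rmult_1_l (Cmod w * Cmod w)) at 2; apply Rmult_le_compat_r; nra.
  - apply Rinv_le_contravar; [nra | apply Rmult_le_compat_r; lra]. }
assert (Hre : Rabs (Re (Clog (z + w) - Clog z - w / z)%C) <= 2 * Cmod w ^ 2 / Cmod z ^ 2).
{ pose proof (mean_value_bound
    (fun t => ln (sqrt ((x + t * u) ^ 2 + (y + t * v) ^ 2)) - t * Re (w / z)%C)
    (fun t => Re (df t)) (2 * Cmod w ^ 2 / Cmod z ^ 2)) as M.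
  cbv beta in M.
  replace (Re (Clog (z + w) - Clog z - w / z)%C) with
    (ln (sqrt ((x + 1 * u) ^ 2 + (y + 1 * v) ^ 2)) - 1 * Re (w / z)%C -
     (ln (sqrt ((x + 0 * u) ^ 2 + (y + 0 * v) ^ 2)) - 0 * Re (w / z)%C)).
  - apply M.
    + intros t Ht; unfold df.
      replace (Re (w / (z + RtoC t * w) - w / z)%C) with
        (((x + t * u) * u + (y + t * v) * v) / ((x + t * u) ^ 2 + (y + t * v) ^ 2)
         - Re (w / z)%C).
      * apply (is_derive_minus (K := R_AbsRing) (V := R_NormedModule));
          [now apply is_derive_ln_modulus, Pt | apply is_derive_linear].
      * specialize (Pt t Ht).
        change (Re (w / (z + RtoC t * w) - w / z)%C) with
          (Re (w / (z + RtoC t * w))%C - Re (w / z)%C); f_equal.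
        rewrite Path; unfold w; rewrite Re_div_pair by auto; f_equal; ring.
    + intros t Ht; eapply Rle_trans; [apply re_le_Cmod | auto].
  - change (Re (Clog (z + w) - Clog z - w / z)%C) with
      (ln (sqrt ((x + u) ^ 2 + (y + v) ^ 2)) - ln (sqrt (x ^ 2 + y ^ 2)) - Re (w / z)%C).
    rewrite !Rmult_1_l, !Rmult_0_l, !Rplus_0_r; ring. }
assert (Him : Rabs (Im (Clog (z + w) - Clog z - w / z)%C) <= 2 * Cmod w ^ 2 / Cmod z ^ 2).
{ pose proof (mean_value_bound
    (fun t => 2 * atan ((y + t * v) /
      (sqrt ((x + t * u) ^ 2 + (y + t * v) ^ 2) + (x + t * u))) - t * Im (w / z)%C)
    (fun t => Im (df t)) (2 * Cmod w ^ 2 / Cmod z ^ 2)) as M.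
  cbv beta in M.
  replace (Im (Clog (z + w) - Clog z - w / z)%C) with
    (2 * atan ((y + 1 * v) /
      (sqrt ((x + 1 * u) ^ 2 + (y + 1 * v) ^ 2) + (x + 1 * u))) - 1 * Im (w / z)%C -
     (2 * atan ((y + 0 * v) /
      (sqrt ((x + 0 * u) ^ 2 + (y + 0 * v) ^ 2) + (x + 0 * u))) - 0 * Im (w / z)%C)).
  - apply M.
    + intros t Ht; unfold df.
      replace (Im (w / (z + RtoC t * w) - w / z)%C) with
        (((x + t * u) * v - (y + t * v) * u) / ((x + t * u) ^ 2 + (y + t * v) ^ 2)
         - Im (w / z)%C).
      * apply (is_derive_minus (K := R_AbsRing) (V := R_NormedModule));
          [now apply is_derive_argument, Pt | apply is_derive_linear].
      * specialize (Pt t Ht).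
        change (Im (w / (z + RtoC t * w) - w / z)%C) with
          (Im (w / (z + RtoC t * w))%C - Im (w / z)%C); f_equal.
        rewrite Path; unfold w; rewrite Im_div_pair by auto; f_equal; ring.
    + intros t Ht; eapply Rle_trans; [apply im_le_Cmod | auto].
  - change (Im (Clog (z + w) - Clog z - w / z)%C) with
      (2 * atan ((y + v) / (sqrt ((x + u) ^ 2 + (y + v) ^ 2) + (x + u))) -
       2 * atan (y / (sqrt (x ^ 2 + y ^ 2) + x)) - Im (w / z)%C).
    rewrite !Rmult_1_l, !Rmult_0_l, !Rplus_0_r; ring. }
eapply Rle_trans; [apply Cmod_le_Re_Im |].
replace (4 * Cmod w ^ 2 / Cmod z ^ 2)
  with (2 * Cmod w ^ 2 / Cmod z ^ 2 + 2 * Cmod w ^ 2 / Cmod z ^ 2) by (field; lra).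
lra.
Qed.

Lemma ln_le_sqrt (x : R) : 1 <= x -> ln x <= 2 * sqrt x.
Proof.
intros Hx.
assert (P : 0 < sqrt x) by (apply sqrt_lt_R0; lra).
rewrite <- (sqrt_sqrt x) at 1 by lra.
rewrite ln_mult by auto.
pose proof (exp_ineq1_le (ln (sqrt x))) as E; rewrite exp_ln in E by auto; lra.
Qed.

Lemma Clog_growth (z : C) : 1 <= Cmod z -> Cmod (Clog z) <= 6 * sqrt (Cmod z).
Proof.
intros Hz; eapply Rle_trans; [apply Cmod_le_Re_Im |].
pose proof (ln_le_sqrt _ Hz) as L.
assert (S : 1 <= sqrt (Cmod z)) by (rewrite <- sqrt_1; apply sqrt_le_1_alt; auto).
assert (P : 0 <= ln (Cmod z)) by (rewrite <- ln_1; apply ln_le; lra).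
change (Re (Clog z)) with (ln (Cmod z)); rewrite (Rabs_pos_eq _ P).
pose proof (Clog_bound z) as B; pose proof PI_4.
assert (Rabs (Im (Clog z)) <= 4) by (apply Rabs_le; lra); lra.
Qed.

Lemma Clog_RtoC (x : R) : 0 < x -> Clog (RtoC x) = RtoC (ln x).
Proof.
intros Hx; unfold Clog; rewrite Cmod_R, Rabs_pos_eq by lra.
apply injective_projections; simpl; auto.
replace (0 / (x + x)) with 0 by (field; lra); rewrite atan_0; ring.
Qed.

(** * The map near infinity *)

Lemma Cmod_add_bound (x y : C) a b : Cmod x <= a -> Cmod y <= b -> Cmod (x + y)%C <= a + b.
Proof. intros; eapply Rle_trans; [apply Cmod_triangle | lra]. Qed.

Lemma Cmod_sub_bound (x y : C) a b : Cmod x <= a -> Cmod y <= b -> Cmod (x - y)%C <= a + b.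
Proof. intros; eapply Rle_trans; [apply Cmod_sub_le | lra]. Qed.

Lemma Cmod_mul_bound (x y : C) a b : Cmod x <= a -> Cmod y <= b -> Cmod (x * y)%C <= a * b.
Proof. intros; rewrite Cmod_mult; apply Rmult_le_compat; auto using Cmod_ge_0. Qed.

Lemma Cmod_opp_bound (x : C) a : Cmod x <= a -> Cmod (- x)%C <= a.
Proof. now rewrite Cmod_opp. Qed.

Lemma Cmod_real_bound (x a : R) : - a <= x <= a -> Cmod (RtoC x) <= a.
Proof. intros; rewrite Cmod_R; now apply Rabs_le. Qed.

(** Triangle inequality along the syntax of an expression; the moduli of the atoms are
    bounded by hypotheses. *)
Ltac bound_leaf :=
  first [ eassumption | apply Cmod_real_bound; split; eassumption
        | apply (Cmod_real_bound _ 1); lra | apply (Cmod_real_bound _ 2); lra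
        | apply (Cmod_real_bound _ 3); lra | apply Rle_refl ].
Ltac bound_step :=
  lazymatch goal with
  | |- Cmod (Cplus _ _) <= _ => eapply Cmod_add_bound; bound_step
  | |- Cmod (Cminus _ _) <= _ => eapply Cmod_sub_bound; bound_step
  | |- Cmod (Cmult _ _) <= _ => eapply Cmod_mul_bound; bound_step
  | |- Cmod (Copp _) <= _ => eapply Cmod_opp_bound; bound_step
  | |- _ => bound_leaf
  end.
Ltac cmod_bound := eapply Rle_trans; [bound_step | try lra].

Definition at_infinity (f : C -> C) (w : C) : C := (- / f (- / w))%C.

Lemma iter_at_infinity f n (w : C) :
  (- / Nat.iter n f (- / w))%C = Nat.iter n (at_infinity f) w.
Proof.
induction n as [| n IH]; simpl.
- rewrite Copp_inv, Cinv_involutive; ring.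
- rewrite <- IH; unfold at_infinity; do 3 f_equal.
  now rewrite Copp_inv, Cinv_involutive; ring_simplify.
Qed.

Lemma iter_of_infinity f n (w : C) :
  Nat.iter n f (- / w)%C = (- / Nat.iter n (at_infinity f) w)%C.
Proof. rewrite <- iter_at_infinity, Copp_inv, Cinv_involutive; ring. Qed.


Lemma Cmod_inv_le (w : C) rho : 0 < rho -> rho <= Cmod w -> Cmod (/ w)%C <= / rho.
Proof.
intros H1 H2; rewrite Cmod_inv; [now apply Rinv_le_contravar |].
apply Cmod_gt_0; lra.
Qed.

Lemma Cmod_inv_small (w : C) : 10 <= Cmod w -> Cmod (/ w)%C <= 1 / 10.
Proof. intros H; eapply Rle_trans; [apply (Cmod_inv_le w 10); lra | lra]. Qed.

Lemma neq_0_of_large (w : C) : 10 <= Cmod w -> w <> 0%C.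
Proof. intros H; apply Cmod_gt_0; lra. Qed.

(** [quartic b (- s) = - s * multiplier b s] *)
Definition multiplier (b : R) (s : C) : C := (1 - s - b * (s * s * s))%C.

Lemma multiplier_lower b (s : C) : - (1) <= b <= 1 -> Cmod s <= 1 / 10 ->
  4 / 5 <= Cmod (multiplier b s).
Proof.
intros [b1 b2] Hs; unfold multiplier.
assert (H : Cmod (s + b * (s * s * s))%C <= 1 / 5) by cmod_bound.
pose proof (Cmod_sub_triangle 1 (s + b * (s * s * s))%C) as T; rewrite Cmod_1 in T.
replace (1 - s - b * (s * s * s))%C with (1 - (s + b * (s * s * s)))%C by ring; lra.
Qed.

Lemma multiplier_upper b (s : C) : - (1) <= b <= 1 -> Cmod s <= 1 / 10 ->
  Cmod (multiplier b s) <= 6 / 5.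
Proof. intros [b1 b2] Hs; unfold multiplier; cmod_bound. Qed.

Lemma multiplier_neq_0 b (s : C) : - (1) <= b <= 1 -> Cmod s <= 1 / 10 ->
  multiplier b s <> 0%C.
Proof. intros Hb Hs; apply Cmod_gt_0; pose proof (multiplier_lower b s Hb Hs); lra. Qed.

Lemma multiplier_inv_bound b (s : C) : - (1) <= b <= 1 -> Cmod s <= 1 / 10 ->
  Cmod (/ multiplier b s)%C <= 5 / 4.
Proof.
intros Hb Hs; replace (5 / 4) with (/ (4 / 5)) by field.
apply Cmod_inv_le; [lra | now apply multiplier_lower].
Qed.

Lemma at_infinity_quartic b (w : C) : - (1) <= b <= 1 -> 10 <= Cmod w ->
  at_infinity (quartic b) w = (w / multiplier b (/ w))%C.
Proof.
intros Hb Hw; pose proof (neq_0_of_large w Hw) as Nw.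
pose proof (multiplier_neq_0 b _ Hb (Cmod_inv_small w Hw)) as Nm.
unfold at_infinity; replace (quartic b (- / w)) with (- (/ w * multiplier b (/ w)))%C
  by (unfold quartic, multiplier; field; auto).
rewrite Copp_inv; field; auto.
Qed.

(** The coefficient of [1 / w] is [1 - a]; it is the source of the logarithm in both
    normalizations. *)
Lemma at_infinity_expansion b (w : C) : - (1) <= b <= 1 -> 10 <= Cmod w ->
  Cmod (at_infinity (quartic b) w - w - 1 - / w)%C <= 3 * Cmod (/ w)%C ^ 2.
Proof.
intros Hb Hw; pose proof (neq_0_of_large w Hw) as Nw.
pose proof (Cmod_inv_small w Hw) as Hs.
pose proof (multiplier_neq_0 b _ Hb Hs) as Nm.
pose proof (multiplier_inv_bound b _ Hb Hs) as Bm.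
rewrite at_infinity_quartic by auto.
set (s := (/ w)%C) in *.
replace w with (/ s)%C by (unfold s; apply Cinv_involutive).
assert (Ns : s <> 0%C).
{ unfold s; intro E; apply C1_nz; rewrite <- (Cinv_l w Nw), E; ring. }
replace (/ s / multiplier b s - / s - 1 - s)%C with
  ((s * s) * ((1 + b + b * s + b * (s * s)) * / multiplier b s))%C
  by (unfold multiplier in *; field; auto).
rewrite !Cmod_mult.
assert (B : Cmod (1 + b + b * s + b * (s * s))%C <= 12 / 5) by (destruct Hb; cmod_bound).
replace (3 * Cmod s ^ 2) with ((Cmod s * Cmod s) * (12 / 5 * (5 / 4))) by field.
apply Rmult_le_compat_l; [apply Rmult_le_pos; apply Cmod_ge_0 |].
apply Rmult_le_compat; auto using Cmod_ge_0.
Qed.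

Lemma at_infinity_growth b (w : C) : - (1) <= b <= 1 -> 10 <= Cmod w ->
  Cmod (at_infinity (quartic b) w - w - 1)%C <= 2 * Cmod (/ w)%C.
Proof.
intros Hb Hw; pose proof (at_infinity_expansion b w Hb Hw) as E.
pose proof (Cmod_inv_small w Hw) as Hs; pose proof (Cmod_ge_0 (/ w)%C).
set (F := at_infinity (quartic b) w) in *.
replace (F - w - 1)%C with ((F - w - 1 - / w) + / w)%C by ring.
eapply Rle_trans; [apply Cmod_triangle |]; simpl in E; nra.
Qed.

(** The difference quotient of the map at infinity; on the diagonal it is the
    derivative. *)
Definition slope (b : R) (v w : C) : C :=
  ((1 - (/ v + / w) * (1 + b * (/ v * / v + / w * / w))) /
   (multiplier b (/ v) * multiplier b (/ w)))%C.

Lemma at_infinity_slope b (v w : C) : - (1) <= b <= 1 -> 10 <= Cmod v -> 10 <= Cmod w ->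
  (at_infinity (quartic b) v - at_infinity (quartic b) w)%C = ((v - w) * slope b v w)%C.
Proof.
intros Hb Hv Hw.
pose proof (neq_0_of_large w Hw) as Nw; pose proof (neq_0_of_large v Hv) as Nv.
pose proof (multiplier_neq_0 b _ Hb (Cmod_inv_small w Hw)) as Mw.
pose proof (multiplier_neq_0 b _ Hb (Cmod_inv_small v Hv)) as Mv.
rewrite !at_infinity_quartic by auto; unfold slope.
replace (v / multiplier b (/ v) - w / multiplier b (/ w))%C with
  ((v * multiplier b (/ w) - w * multiplier b (/ v)) /
   (multiplier b (/ v) * multiplier b (/ w)))%C by (field; auto).
unfold Cdiv; rewrite Cmult_assoc; f_equal.
unfold multiplier; field; auto.
Qed.

Lemma slope_sub_1 b (v w : C) rho : - (1) <= b <= 1 -> 10 <= rho ->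
  rho <= Cmod v -> rho <= Cmod w -> Cmod (slope b v w - 1)%C <= 5 / rho ^ 2.
Proof.
intros Hb Hr Hv Hw.
pose proof (Cmod_inv_small w ltac:(lra)) as Sw; pose proof (Cmod_inv_small v ltac:(lra)) as Sv.
pose proof (multiplier_neq_0 b _ Hb Sw) as Mw; pose proof (multiplier_neq_0 b _ Hb Sv) as Mv.
pose proof (multiplier_inv_bound b _ Hb Sw) as Iw.
pose proof (multiplier_inv_bound b _ Hb Sv) as Iv.
pose proof (Cmod_inv_le w rho ltac:(lra) Hw) as Rw.
pose proof (Cmod_inv_le v rho ltac:(lra) Hv) as Rv.
unfold slope; set (x := (/ v)%C) in *; set (y := (/ w)%C) in *.
replace ((1 - (x + y) * (1 + b * (x * x + y * y))) / (multiplier b x * multiplier b y) - 1)%C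
  with (- (x * y) * ((1 + b * (x + y) + b * (x * x + y * y) + b * b * (x * x * (y * y))) *
        (/ multiplier b x * / multiplier b y)))%C
  by (unfold multiplier in *; field; auto).
assert (P : Cmod (1 + b * (x + y) + b * (x * x + y * y) + b * b * (x * x * (y * y)))%C <= 3 / 2)
  by (clear Rv Rw; destruct Hb; cmod_bound).
assert (P2 : Cmod (/ multiplier b x * / multiplier b y)%C <= 5 / 4 * (5 / 4))
  by now apply Cmod_mul_bound.
assert (P3 : Cmod (- (x * y))%C <= / rho * / rho) by now apply Cmod_opp_bound, Cmod_mul_bound.
eapply Rle_trans; [apply Cmod_mul_bound; [apply P3 | apply Cmod_mul_bound; [apply P | apply P2]] |].
replace (5 / rho ^ 2) with (/ rho * / rho * 5) by (field; lra).
apply Rmult_le_compat_l; [| lra].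
apply Rmult_le_pos; left; apply Rinv_0_lt_compat; lra.
Qed.

Lemma slope_diag b (v w : C) rho : - (1) <= b <= 1 -> 10 <= rho ->
  rho <= Cmod v -> rho <= Cmod w ->
  Cmod (slope b v w - slope b w w)%C <= 5 / rho ^ 2 * Cmod (v - w)%C.
Proof.
intros Hb Hr Hv Hw.
pose proof (neq_0_of_large w ltac:(lra)) as Nw; pose proof (neq_0_of_large v ltac:(lra)) as Nv.
pose proof (Cmod_inv_small w ltac:(lra)) as Sw; pose proof (Cmod_inv_small v ltac:(lra)) as Sv.
pose proof (multiplier_neq_0 b _ Hb Sw) as Mw; pose proof (multiplier_neq_0 b _ Hb Sv) as Mv.
pose proof (multiplier_inv_bound b _ Hb Sw) as Iw.
pose proof (multiplier_inv_bound b _ Hb Sv) as Iv.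
pose proof (multiplier_upper b _ Hb Sw) as Uw.
pose proof (Cmod_inv_le w rho ltac:(lra) Hw) as Rw.
pose proof (Cmod_inv_le v rho ltac:(lra) Hv) as Rv.
assert (D : (v - w)%C = ((/ w - / v) * (v * w))%C) by (field; auto).
unfold slope; set (x := (/ v)%C) in *; set (y := (/ w)%C) in *.
set (N := (- multiplier b y * (1 + b * (x * x + 2 * (x * y) + 3 * (y * y))) +
           (1 - (y + y) * (1 + b * (y * y + y * y))) * (1 + b * (x * x + x * y + y * y)))%C).
replace ((1 - (x + y) * (1 + b * (x * x + y * y))) / (multiplier b x * multiplier b y) -
         (1 - (y + y) * (1 + b * (y * y + y * y))) / (multiplier b y * multiplier b y))%C
  with ((x - y) * (N * (/ multiplier b x * (/ multiplier b y * / multiplier b y))))%C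
  by (unfold N, multiplier in *; field; auto).
assert (P : Cmod N <= 64 / 25).
{ unfold N; clear Rv Rw; destruct Hb.
  eapply Rle_trans; [apply Cmod_add_bound; apply Cmod_mul_bound |].
  - apply Cmod_opp_bound, Uw.
  - bound_step.
  - bound_step.
  - bound_step.
  - lra. }
assert (P2 : Cmod (/ multiplier b x * (/ multiplier b y * / multiplier b y))%C
             <= 5 / 4 * (5 / 4 * (5 / 4))) by (repeat apply Cmod_mul_bound; auto).
assert (P3 : Cmod (x - y)%C <= / rho * / rho * Cmod (v - w)%C).
{ replace (x - y)%C with (- (v - w) * (x * y))%C by (unfold x, y; field; auto).
  rewrite Cmod_mult, Cmod_opp, Rmult_comm; apply Rmult_le_compat_r; [apply Cmod_ge_0 |].
  now apply Cmod_mul_bound. }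
eapply Rle_trans; [apply Cmod_mul_bound; [apply P3 | apply Cmod_mul_bound; [apply P | apply P2]] |].
replace (5 / rho ^ 2 * Cmod (v - w)%C) with (/ rho * / rho * Cmod (v - w)%C * 5) by (field; lra).
apply Rmult_le_compat_l; [| lra].
repeat apply Rmult_le_pos; auto using Cmod_ge_0; left; apply Rinv_0_lt_compat; lra.
Qed.

(** * Pairs of orbits near infinity *)

Fixpoint iter_derivative (b : R) (w : C) (n : nat) : C :=
  match n with
  | O => 1%C
  | S k => (slope b (Nat.iter k (at_infinity (quartic b)) w)
                    (Nat.iter k (at_infinity (quartic b)) w) * iter_derivative b w k)%C
  end.

(** The slope of the map at infinity is [1 + O(1 / w^2)], so along orbits on which
    [1 / w^2] is summable the iterates distort distances by a bounded factor and
    have bounded second-order remainders.  The sequence [s] stands for the partial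
    sums of [5 / rho^2]; keeping it below [1 / 2] lets [1 + 2 s] dominate the product
    of the factors [1 + 5 / rho^2]. *)
Lemma iter_distortion b (v w p h : C) (rho s : nat -> R) (n : nat) : - (1) <= b <= 1 ->
  (forall k, (k < n)%nat -> 10 <= rho k /\
     rho k <= Cmod (Nat.iter k (at_infinity (quartic b)) v) /\
     rho k <= Cmod (Nat.iter k (at_infinity (quartic b)) w)) ->
  0 <= s 0%nat -> (forall k, (k < n)%nat -> s k + 5 / rho k ^ 2 <= s (S k)) ->
  (forall k, (k <= n)%nat -> s k <= 1 / 2) ->
  forall k, (k <= n)%nat -> 0 <= s k /\
    Cmod (Nat.iter k (at_infinity (quartic b)) v - Nat.iter k (at_infinity (quartic b)) w)%C
      <= (1 + 2 * s k) * Cmod (v - w)%C /\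
    Cmod (Nat.iter k (at_infinity (quartic b)) v - Nat.iter k (at_infinity (quartic b)) w
          - iter_derivative b w k * p * h)%C
      <= (1 + 2 * s k) * Cmod (v - w - p * h)%C + 8 * s k * Cmod (v - w)%C ^ 2.
Proof.
intros Hb Hrho H0 Hs Hs2 k; induction k as [| k IH]; intros Hk.
- simpl; replace (v - w - 1 * p * h)%C with (v - w - p * h)%C by ring.
  pose proof (Cmod_ge_0 (v - w)%C); pose proof (Cmod_ge_0 (v - w - p * h)%C).
  repeat split; auto; nra.
- destruct (IH ltac:(lia)) as (P & L & Q); clear IH.
  destruct (Hrho k ltac:(lia)) as (R1 & R2 & R3).
  specialize (Hs k ltac:(lia)); pose proof (Hs2 (S k) Hk) as HS.
  simpl; set (vk := Nat.iter k (at_infinity (quartic b)) v) in *.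
  set (wk := Nat.iter k (at_infinity (quartic b)) w) in *.
  pose proof (slope_sub_1 b vk wk (rho k) Hb R1 R2 R3) as A1.
  pose proof (slope_sub_1 b wk wk (rho k) Hb R1 R3 R3) as A2.
  pose proof (slope_diag b vk wk (rho k) Hb R1 R2 R3) as A3.
  assert (a0 : 0 <= 5 / rho k ^ 2).
  { apply Rlt_le, Rdiv_lt_0_compat; [lra | apply pow_lt; lra]. }
  set (a := 5 / rho k ^ 2) in *.
  assert (B1 : Cmod (slope b vk wk) <= 1 + a).
  { replace (slope b vk wk) with (1 + (slope b vk wk - 1))%C by ring.
    eapply Rle_trans; [apply Cmod_triangle |]; rewrite Cmod_1; lra. }
  assert (B2 : Cmod (slope b wk wk) <= 1 + a).
  { replace (slope b wk wk) with (1 + (slope b wk wk - 1))%C by ring.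
    eapply Rle_trans; [apply Cmod_triangle |]; rewrite Cmod_1; lra. }
  rewrite at_infinity_slope by (auto; lra).
  pose proof (Cmod_ge_0 (v - w)%C) as D0; pose proof (Cmod_ge_0 (v - w - p * h)%C) as E0.
  set (d := Cmod (v - w)%C) in *; set (e := Cmod (v - w - p * h)%C) in *.
  assert (Hak : (1 + a) * (1 + 2 * s k) <= 1 + 2 * s (S k)).
  { assert (a * (1 + 2 * s k) <= a * 2) by (apply Rmult_le_compat_l; lra); nra. }
  split; [lra |]; split.
  + rewrite Cmod_mult; eapply Rle_trans;
      [apply Rmult_le_compat; [apply Cmod_ge_0 | apply Cmod_ge_0 | apply L | apply B1] |].
    apply Rle_trans with (((1 + a) * (1 + 2 * s k)) * d); [right; ring |].
    apply Rmult_le_compat_r; auto.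
  + set (q := (iter_derivative b w k * p * h)%C) in *.
    replace ((vk - wk) * slope b vk wk - slope b wk wk * iter_derivative b w k * p * h)%C
      with (slope b wk wk * (vk - wk - q) + (slope b vk wk - slope b wk wk) * (vk - wk))%C
      by (unfold q; ring).
    eapply Rle_trans; [apply Cmod_triangle |]; rewrite !Cmod_mult.
    assert (L2 : Cmod (vk - wk)%C <= 2 * d) by nra.
    assert (X1 : Cmod (slope b wk wk) * Cmod (vk - wk - q)%C <=
                 (1 + a) * ((1 + 2 * s k) * e + 8 * s k * d ^ 2))
      by (apply Rmult_le_compat; auto using Cmod_ge_0).
    assert (X2 : Cmod (slope b vk wk - slope b wk wk)%C * Cmod (vk - wk)%C
                 <= (a * (2 * d)) * (2 * d)).
    { apply Rmult_le_compat; auto using Cmod_ge_0.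
      eapply Rle_trans; [apply A3 |]; apply Rmult_le_compat_l; auto. }
    assert (X3 : (1 + a) * (1 + 2 * s k) * e <= (1 + 2 * s (S k)) * e)
      by (apply Rmult_le_compat_r; auto).
    assert (D2 : 0 <= d ^ 2) by (apply pow2_ge_0).
    assert (X4 : (8 * s k * (1 + a) + 4 * a) * d ^ 2 <= 8 * s (S k) * d ^ 2).
    { apply Rmult_le_compat_r; auto.
      assert (a * s k <= a * (1 / 2)) by (apply Rmult_le_compat_l; lra); nra. }
    simpl in *; nra.
Qed.

Lemma telescoping_bound (u : nat -> C) (tau : nat -> R) n :
  (forall k, (n <= k)%nat -> Cmod (u (S k) - u k)%C <= tau k - tau (S k)) ->
  forall m, (n <= m)%nat -> Cmod (u m - u n)%C <= tau n - tau m.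
Proof.
intros H m Hm; induction Hm as [| m Hm IH].
- replace (u n - u n)%C with (RtoC 0) by ring; rewrite Cmod_0; lra.
- replace (u (S m) - u n)%C with ((u (S m) - u m) + (u m - u n))%C by ring.
  eapply Rle_trans; [apply Cmod_triangle |]; specialize (H m Hm); lra.
Qed.

Lemma inv_square_telescopes (x : R) : 1 <= x -> / x ^ 2 <= 4 * (/ x - / (x + 1 / 2)).
Proof.
intros Hx.
replace (4 * (/ x - / (x + 1 / 2))) with (/ x ^ 2 * (2 * x / (x + 1 / 2))) by (field; lra).
rewrite <- (Rmult_1_r (/ x ^ 2)) at 1.
apply Rmult_le_compat_l; [left; apply Rinv_0_lt_compat, pow_lt; lra |].
apply Rle_div_r; lra.
Qed.

(** * The attracting Fatou coordinate *)

(** In the coordinate [w = - 1 / z]; the threshold only has to make the error terms small. *)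
Definition petal (w : C) : Prop := 100 <= Re w.

Lemma Re_step b (w : C) : - (1) <= b <= 1 -> 10 <= Cmod w ->
  Re w + 1 / 2 <= Re (at_infinity (quartic b) w).
Proof.
intros Hb Hw; pose proof (at_infinity_growth b w Hb Hw) as G.
pose proof (Cmod_inv_small w Hw).
pose proof (Re_ge_Cmod (at_infinity (quartic b) w - w - 1)%C) as T.
change (Re (at_infinity (quartic b) w - w - 1)%C) with
  (Re (at_infinity (quartic b) w) - Re w - 1) in T; lra.
Qed.

Lemma petal_orbit b (w : C) k : - (1) <= b <= 1 -> petal w ->
  Re w + INR k / 2 <= Re (Nat.iter k (at_infinity (quartic b)) w).
Proof.
intros Hb Hw; unfold petal in Hw; induction k as [| k IH].
- simpl; lra.
- rewrite S_INR, Nat.iter_succ; pose proof (pos_INR k).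
  pose proof (Re_le_Cmod (Nat.iter k (at_infinity (quartic b)) w)) as RC.
  pose proof (Re_step b (Nat.iter k (at_infinity (quartic b)) w) Hb ltac:(lra)); lra.
Qed.

(** The increment of the logarithm cancels the term [1 / w] of the map at infinity; the
    error that is left is summable along orbits. *)
Lemma approximate_abel b (w : C) : - (1) <= b <= 1 -> petal w ->
  Cmod ((at_infinity (quartic b) w - Clog (at_infinity (quartic b) w)) - (w - Clog w) - 1)%C
    <= 11 * Cmod (/ w)%C ^ 2.
Proof.
intros Hb Hw; unfold petal in Hw; pose proof (Re_le_Cmod w) as Hwc.
pose proof (neq_0_of_large w ltac:(lra)) as Nw.
pose proof (at_infinity_expansion b w Hb ltac:(lra)) as E.
pose proof (at_infinity_growth b w Hb ltac:(lra)) as G.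
pose proof (Re_step b w Hb ltac:(lra)) as S.
pose proof (Cmod_inv_small w ltac:(lra)) as Iw.
set (F := at_infinity (quartic b) w) in *.
assert (U : Cmod (F - w)%C <= 6 / 5).
{ replace (F - w)%C with ((F - w - 1) + 1)%C by ring.
  eapply Rle_trans; [apply Cmod_triangle |]; rewrite Cmod_1; lra. }
pose proof (Clog_expansion w (F - w)%C) as L.
replace (w + (F - w))%C with F in L by ring.
specialize (L ltac:(lra) ltac:(lra) ltac:(lra)).
assert (L2 : Cmod (Clog F - Clog w - (F - w) / w)%C <= 6 * Cmod (/ w)%C ^ 2).
{ eapply Rle_trans; [apply L |].
  rewrite Cmod_inv, pow_inv by auto; apply Rmult_le_compat_r.
  - left; apply Rinv_0_lt_compat, pow_lt; lra.
  - pose proof (Cmod_ge_0 (F - w)%C); simpl; nra. }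
replace (F - Clog F - (w - Clog w) - 1)%C with
  ((F - w - 1 - / w) - (F - w - 1) * / w - (Clog F - Clog w - (F - w) / w))%C
  by (field; auto).
assert (L3 : Cmod ((F - w - 1) * / w)%C <= 2 * Cmod (/ w)%C ^ 2).
{ rewrite Cmod_mult; pose proof (Cmod_ge_0 (/ w)%C); simpl; nra. }
eapply Rle_trans; [apply Cmod_sub_bound; [apply Cmod_sub_bound |]; eassumption |]; lra.
Qed.

Definition abel_approx (b : R) (w : C) (n : nat) : C :=
  (Nat.iter n (at_infinity (quartic b)) w - INR n
     - Clog (Nat.iter n (at_infinity (quartic b)) w))%C.

Lemma abel_approx_close b (w : C) n m : - (1) <= b <= 1 -> petal w -> (n <= m)%nat ->
  Cmod (abel_approx b w m - abel_approx b w n)%C <= 44 / (Re w + INR n / 2).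
Proof.
intros Hb Hw Hnm; pose proof Hw as Hw'; unfold petal in Hw'.
eapply Rle_trans.
- apply (telescoping_bound (abel_approx b w) (fun k => 44 / (Re w + INR k / 2)) n); auto.
  intros k _; pose proof (petal_orbit b w k Hb Hw) as P; pose proof (pos_INR k).
  unfold abel_approx; rewrite S_INR; simpl Nat.iter.
  set (wk := Nat.iter k (at_infinity (quartic b)) w) in *.
  assert (Pk : petal wk) by (unfold petal; lra).
  pose proof (approximate_abel b wk Hb Pk) as A.
  replace (at_infinity (quartic b) wk - RtoC (INR k + 1) - Clog (at_infinity (quartic b) wk)
     - (wk - INR k - Clog wk))%C with
    (at_infinity (quartic b) wk - Clog (at_infinity (quartic b) wk) - (wk - Clog wk) - 1)%C
    by (rewrite RtoC_plus; ring).
  eapply Rle_trans; [apply A |].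
  pose proof (Re_le_Cmod wk).
  pose proof (Cmod_inv_le wk (Re w + INR k / 2) ltac:(lra) ltac:(lra)) as I.
  pose proof (inv_square_telescopes (Re w + INR k / 2) ltac:(lra)) as T.
  assert (I2 : Cmod (/ wk)%C ^ 2 <= / (Re w + INR k / 2) ^ 2).
  { rewrite <- pow_inv; apply pow_incr; split; auto using Cmod_ge_0. }
  replace (Re w + (INR k + 1) / 2) with (Re w + INR k / 2 + 1 / 2) by field.
  unfold Rdiv at 1 2; lra.
- pose proof (pos_INR m).
  assert (0 <= 44 / (Re w + INR m / 2)) by (apply Rlt_le, Rdiv_lt_0_compat; lra); lra.
Qed.

Lemma small_inverse (k eps : R) : 0 < eps -> 0 <= k ->
  exists N : nat, forall n x, (N <= n)%nat -> 1 <= x -> k / (x + INR n / 2) < eps.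
Proof.
intros He Hk.
destruct (nfloor_ex (2 * k / eps)) as [N [_ HN]].
{ apply Rmult_le_pos; [lra | left; now apply Rinv_0_lt_compat]. }
exists (S N); intros n x Hn Hx.
apply le_INR in Hn; rewrite S_INR in Hn.
apply Rmult_lt_reg_r with (x + INR n / 2); [pose proof (pos_INR N); lra |].
unfold Rdiv at 1; rewrite Rmult_assoc, Rinv_l by (pose proof (pos_INR N); lra).
assert (2 * k < INR n * eps).
{ replace (2 * k) with (2 * k / eps * eps) by (field; lra).
  apply Rmult_lt_compat_r; lra. }
nra.
Qed.

Lemma abel_approx_converges b (w : C) : - (1) <= b <= 1 -> petal w ->
  exists l, cconv (abel_approx b w) l.
Proof.
intros Hb Hw; apply cconv_cauchy; intros eps He.
destruct (small_inverse 44 (eps / 2)) as [N HN]; [lra | lra |].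
exists N.
assert (X : forall n, (N <= n)%nat -> Cmod (abel_approx b w n - abel_approx b w N)%C < eps / 2).
{ intros n Hn; eapply Rle_lt_trans; [now apply abel_approx_close |].
  apply HN; auto; unfold petal in Hw; lra. }
intros n m Hn Hm; pose proof (X n Hn); pose proof (X m Hm).
replace (abel_approx b w n - abel_approx b w m)%C with
  ((abel_approx b w n - abel_approx b w N) - (abel_approx b w m - abel_approx b w N))%C by ring.
eapply Rle_lt_trans; [apply Cmod_sub_le | lra].
Qed.

Definition petal_coordinate (b : R) (w : C) : C := Clim (abel_approx b w).

Lemma petal_coordinate_lim b (w : C) : - (1) <= b <= 1 -> petal w ->
  cconv (abel_approx b w) (petal_coordinate b w).
Proof. intros; now apply Clim_cconv, abel_approx_converges. Qed.

Lemma petal_coordinate_asymptotics b (w : C) : - (1) <= b <= 1 -> petal w ->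
  Cmod (petal_coordinate b w - (w - Clog w))%C <= 44 / Re w.
Proof.
intros Hb Hw; apply cconv_le with (abel_approx b w); [| now apply petal_coordinate_lim].
exists 0%nat; intros n Hn; pose proof (abel_approx_close b w 0 n Hb Hw Hn) as H.
unfold abel_approx at 2 in H; simpl in H.
replace (w - 0 - Clog w)%C with (w - Clog w)%C in H by ring.
now replace (Re w + 0 / 2) with (Re w) in H by field.
Qed.

Lemma petal_distortion b (w h : C) n : - (1) <= b <= 1 -> 101 <= Re w -> Cmod h < 1 ->
  Cmod (Nat.iter n (at_infinity (quartic b)) (w + h) - Nat.iter n (at_infinity (quartic b)) w)%C
    <= 2 * Cmod h /\
  Cmod (Nat.iter n (at_infinity (quartic b)) (w + h) - Nat.iter n (at_infinity (quartic b)) w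
          - iter_derivative b w n * h)%C <= 4 * Cmod h ^ 2.
Proof.
intros Hb Hw Hh.
assert (Hp : petal w) by (unfold petal; lra).
assert (Hq : petal (w + h)%C).
{ unfold petal; change (100 <= Re w + Re h); pose proof (Re_ge_Cmod h); lra. }
pose proof (iter_distortion b (w + h)%C w 1 h (fun k => 100 + INR k / 2)
  (fun k => 20 * (/ 100 - / (100 + INR k / 2))) n Hb) as D; cbv beta in D.
assert (K : forall k, 0 <= INR k / 2) by (intro k; pose proof (pos_INR k); lra).
assert (I : forall k, 0 < / (100 + INR k / 2)).
{ intro k; specialize (K k); apply Rinv_0_lt_compat; lra. }
destruct D with (k := n) as (_ & D1 & D2); auto.
- intros k _; specialize (K k); split; [lra |].
  pose proof (petal_orbit b w k Hb Hp); pose proof (petal_orbit b (w + h)%C k Hb Hq).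
  unfold petal in Hp, Hq; split; eapply Rle_trans; [| apply Re_le_Cmod | | apply Re_le_Cmod]; lra.
- simpl; replace (100 + 0 / 2) with 100 by field; lra.
- intros k _; specialize (K k).
  pose proof (inv_square_telescopes (100 + INR k / 2) ltac:(lra)) as T.
  rewrite S_INR; replace (100 + (INR k + 1) / 2) with (100 + INR k / 2 + 1 / 2) by field.
  unfold Rdiv at 2; lra.
- intros k _; specialize (I k); lra.
- specialize (I n).
  replace (w + h - w)%C with h in D1, D2 by ring.
  replace (h - 1 * h)%C with (RtoC 0) in D2 by ring; rewrite Cmod_0 in D2.
  replace (iter_derivative b w n * 1 * h)%C with (iter_derivative b w n * h)%C in D2 by ring.
  pose proof (Cmod_ge_0 h); split.
  + eapply Rle_trans; [apply D1 |]; apply Rmult_le_compat_r; lra.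
  + eapply Rle_trans; [apply D2 |]; pose proof (pow2_ge_0 (Cmod h)); nra.
Qed.

Lemma petal_coordinate_derivable b (w : C) : - (1) <= b <= 1 -> 101 <= Re w ->
  exists l, cderiv (petal_coordinate b) w l.
Proof.
intros Hb Hw.
assert (Hp : petal w) by (unfold petal; lra).
apply (cderiv_limit (fun n x => abel_approx b x n) _
  (fun n => iter_derivative b w n * (1 - / Nat.iter n (at_infinity (quartic b)) w))%C
  w 5 1 Rlt_0_1).
- intros h Hh; apply petal_coordinate_lim; auto.
  unfold petal; change (100 <= Re w + Re h); pose proof (Re_ge_Cmod h); lra.
- intros n h Hh; destruct (petal_distortion b w h n Hb Hw Hh) as [D1 D2].
  assert (Hq : petal (w + h)%C).
  { unfold petal; change (100 <= Re w + Re h); pose proof (Re_ge_Cmod h); lra. }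
  pose proof (petal_orbit b w n Hb Hp) as P; pose proof (petal_orbit b (w + h)%C n Hb Hq) as Q.
  unfold petal in Hp, Hq; pose proof (pos_INR n).
  unfold abel_approx.
  set (vn := Nat.iter n (at_infinity (quartic b)) (w + h)%C) in *.
  set (wn := Nat.iter n (at_infinity (quartic b)) w) in *.
  pose proof (Re_le_Cmod wn) as Cw.
  pose proof (neq_0_of_large wn ltac:(lra)) as Nw.
  pose proof (Clog_expansion wn (vn - wn)%C) as L.
  replace (wn + (vn - wn))%C with vn in L by ring.
  specialize (L ltac:(lra) ltac:(lra) ltac:(lra)).
  set (dp := iter_derivative b w n) in *.
  replace (vn - INR n - Clog vn - (wn - INR n - Clog wn) - dp * (1 - / wn) * h)%C with
    ((vn - wn - dp * h) * (1 - / wn) - (Clog vn - Clog wn - (vn - wn) / wn))%C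
    by (field; auto).
  pose proof (Cmod_inv_small wn ltac:(lra)) as I.
  pose proof (Cmod_ge_0 h) as H0.
  eapply Rle_trans; [apply Cmod_sub_bound; [apply Cmod_mul_bound; [apply D2 |] | apply L] |].
  + apply Cmod_sub_bound; [rewrite Cmod_1; apply Rle_refl | apply I].
  + assert (X : 4 * Cmod (vn - wn)%C ^ 2 / Cmod wn ^ 2 <= 16 * Cmod h ^ 2 / 100).
    { apply Rmult_le_compat.
      - pose proof (pow2_ge_0 (Cmod (vn - wn)%C)); lra.
      - left; apply Rinv_0_lt_compat, pow_lt; lra.
      - pose proof (Cmod_ge_0 (vn - wn)%C); simpl; nra.
      - apply Rinv_le_contravar; simpl; nra. }
    pose proof (pow2_ge_0 (Cmod h)); lra.
Qed.

Lemma locally_0_Cmod (eps : R) : 0 < eps ->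
  locally (RtoC 0) (fun z : C => Cmod z < eps).
Proof.
intros He; assert (S : 0 < sqrt 2) by (apply sqrt_lt_R0; lra).
exists (mkposreal (eps / sqrt 2) (Rdiv_lt_0_compat _ _ He S)); intros y Hy.
apply C_NormedModule_mixin_compat2 in Hy; simpl in Hy.
change (Cmod (y - 0)%C < sqrt 2 * (eps / sqrt 2)) in Hy.
assert (E : forall a : C, (a - 0)%C = a) by (intros; ring); rewrite (E y) in Hy.
replace (sqrt 2 * (eps / sqrt 2)) with eps in Hy by (field; lra); auto.
Qed.

Lemma basin_enters_petal b (z : C) (X : R) : - (1) <= b <= 1 ->
  parabolic_basin (quartic b) z ->
  exists N, X <= Re (- / Nat.iter N (quartic b) z)%C.
Proof.
intros Hb [Hlim Hnz].
assert (H10 : 0 < 1 / 10) by lra.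
destruct (Hlim _ (locally_0_Cmod (1 / 10) H10)) as [N HN].
assert (Big : forall n, (N <= n)%nat -> 10 <= Cmod (- / Nat.iter n (quartic b) z)%C).
{ intros n Hn; specialize (HN n Hn); cbv beta in HN.
  rewrite Cmod_opp, Cmod_inv by auto.
  replace 10 with (/ (1 / 10)) by field; apply Rinv_le_contravar; [| lra].
  now apply Cmod_gt_0. }
assert (Step : forall k, Re (- / Nat.iter N (quartic b) z)%C + INR k / 2 <=
                         Re (- / Nat.iter (N + k) (quartic b) z)%C).
{ induction k as [| k IH]; [simpl; rewrite Nat.add_0_r; lra |].
  pose proof (Re_step b _ Hb (Big (N + k)%nat ltac:(lia))) as S.
  unfold at_infinity in S; rewrite Copp_inv, Cinv_involutive in S.
  replace (- - Nat.iter (N + k) (quartic b) z)%C with (Nat.iter (N + k) (quartic b) z) in S by ring.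
  rewrite Nat.add_succ_r, S_INR; simpl Nat.iter; lra. }
destruct (INR_unbounded (2 * (X - Re (- / Nat.iter N (quartic b) z)%C))) as [k Hk].
exists (N + k)%nat; specialize (Step k); lra.
Qed.

Lemma cderiv_quartic b (z : C) : cderiv (quartic b) z (1 + 2 * z + 4 * b * z ^ 3)%C.
Proof.
apply (cderiv_of_quadratic _ _ _ (1 + Rabs b * (6 * Cmod z ^ 2 + 4 * Cmod z + 1)) 1 Rlt_0_1).
intros h Hh; unfold quartic.
replace (z + h + (z + h) ^ 2 + b * (z + h) ^ 4 - (z + z ^ 2 + b * z ^ 4)
         - (1 + 2 * z + 4 * b * z ^ 3) * h)%C
  with ((1 + b * (6 * (z * z) + 4 * z * h + h * h)) * (h * h))%C by ring.
rewrite (Cmod_mult _ (h * h)%C), (Cmod_mult h h).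
replace (Cmod h ^ 2) with (Cmod h * Cmod h) by ring.
pose proof (Cmod_ge_0 h); pose proof (Cmod_ge_0 z); pose proof (Rabs_pos b).
apply Rmult_le_compat_r; [nra |].
eapply Rle_trans; [apply Cmod_triangle |]; rewrite Cmod_1, Cmod_mult, Cmod_R.
apply Rplus_le_compat_l, Rmult_le_compat_l; auto.
eapply Rle_trans; [apply Cmod_add_bound; [apply Cmod_add_bound |] |].
- rewrite !Cmod_mult, Cmod_R, (Rabs_pos_eq 6) by lra; apply Rle_refl.
- rewrite !Cmod_mult, Cmod_R, (Rabs_pos_eq 4) by lra; apply Rle_refl.
- rewrite Cmod_mult; apply Rle_refl.
- nra.
Qed.

Lemma cderiv_iter_quartic b n (z : C) : exists l, cderiv (Nat.iter n (quartic b)) z l.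
Proof.
induction n as [| n [l IH]].
- exists 1%C; apply (cderiv_of_quadratic _ _ _ 0 1 Rlt_0_1); intros h _; simpl.
  replace (z + h - z - 1 * h)%C with (RtoC 0) by ring; rewrite Cmod_0; lra.
- eexists; simpl; apply (cderiv_comp (quartic b) (Nat.iter n (quartic b)));
    [apply IH | apply cderiv_quartic].
Qed.

(** A limit, rather than a pull-back from the petal, so that the Abel equation is a
    shift of indices. *)
Definition fatou_coordinate (b : R) (z : C) : C :=
  Clim (fun n => - / Nat.iter n (quartic b) z - INR n - Clog (- / Nat.iter n (quartic b) z))%C.

Lemma fatou_coordinate_from_petal b (z : C) N : - (1) <= b <= 1 ->
  petal (- / Nat.iter N (quartic b) z)%C ->
  cconv (fun n => - / Nat.iter n (quartic b) z - INR n - Clog (- / Nat.iter n (quartic b) z))%C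
    (petal_coordinate b (- / Nat.iter N (quartic b) z) - INR N)%C.
Proof.
intros Hb Hp; apply (cconv_shift _ _ N).
pose proof (cconv_add_const _ _ (- INR N)%C (petal_coordinate_lim b _ Hb Hp)) as L.
refine (cconv_ext _ _ _ _ L); exists 0%nat; intros n _.
unfold abel_approx; rewrite <- iter_at_infinity.
replace (- / - / Nat.iter N (quartic b) z)%C with (Nat.iter N (quartic b) z)
  by (rewrite Copp_inv, Cinv_involutive; ring).
rewrite <- Nat.iter_add, plus_INR, RtoC_plus; ring.
Qed.

Lemma fatou_coordinate_lim b (z : C) : - (1) <= b <= 1 -> parabolic_basin (quartic b) z ->
  cconv (fun n => - / Nat.iter n (quartic b) z - INR n - Clog (- / Nat.iter n (quartic b) z))%C
    (fatou_coordinate b z).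
Proof.
intros Hb Hz; apply Clim_cconv.
destruct (basin_enters_petal b z 100 Hb Hz) as [N HN].
eexists; apply (fatou_coordinate_from_petal b z N Hb HN).
Qed.

(** Near a basin point the coordinate is the petal coordinate pulled back by an iterate;
    keeping the derivative of that iterate as a factor exposes the critical points. *)
Lemma fatou_coordinate_derivable_at b (z : C) N l : - (1) <= b <= 1 ->
  parabolic_basin (quartic b) z -> 102 <= Re (- / Nat.iter N (quartic b) z)%C ->
  cderiv (Nat.iter N (quartic b)) z l -> exists k, cderiv (fatou_coordinate b) z (k * l)%C.
Proof.
intros Hb Hz HN D1.
pose proof (cderiv_opp_inv _ (proj2 Hz N)) as D2.
pose proof (cderiv_comp (fun x => - / x)%C _ _ _ _ D1 D2) as D3; cbv beta in D3.
destruct (petal_coordinate_derivable b _ Hb (Rle_trans 101 102 _ ltac:(lra) HN)) as [l4 D4].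
pose proof (cderiv_comp (petal_coordinate b) _ _ _ _ D3 D4) as D5; cbv beta in D5.
pose proof (cderiv_add_const _ _ _ (- INR N)%C D5) as D6; rewrite Cmult_assoc in D6.
destruct (cderiv_continuous _ _ _ D3 1 Rlt_0_1) as (d & Hd & Cont).
eexists; refine (cderiv_ext_loc _ _ _ _ d Hd _ D6); intros h Hh.
symmetry; apply Clim_eq, (fatou_coordinate_from_petal b (z + h)%C N Hb).
unfold petal; specialize (Cont h Hh).
pose proof (Re_ge_Cmod (- / Nat.iter N (quartic b) (z + h) - - / Nat.iter N (quartic b) z)%C) as T.
change (Re (- / Nat.iter N (quartic b) (z + h) - - / Nat.iter N (quartic b) z)%C) with
  (Re (- / Nat.iter N (quartic b) (z + h))%C - Re (- / Nat.iter N (quartic b) z)%C) in T; lra.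
Qed.

Lemma fatou_coordinate_derivable b (z : C) : - (1) <= b <= 1 ->
  parabolic_basin (quartic b) z -> exists l, cderiv (fatou_coordinate b) z l.
Proof.
intros Hb Hz; destruct (basin_enters_petal b z 102 Hb Hz) as [N HN].
destruct (cderiv_iter_quartic b N z) as [l D].
destruct (fatou_coordinate_derivable_at b z N l Hb Hz HN D) as [k Hk]; eauto.
Qed.

Lemma fatou_coordinate_abel b (z : C) : - (1) <= b <= 1 -> parabolic_basin (quartic b) z ->
  fatou_coordinate b (quartic b z) = (fatou_coordinate b z + 1)%C.
Proof.
intros Hb Hz; apply Clim_eq.
pose proof (cconv_unshift _ _ 1 (fatou_coordinate_lim b z Hb Hz)) as L.
refine (cconv_ext _ _ _ _ (cconv_add_const _ _ 1%C L)); exists 0%nat; intros n _.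
rewrite Nat.add_1_r, <- Nat.iter_succ_r, S_INR, RtoC_plus; ring.
Qed.

Theorem fatou_coordinate_attracting b : - (1) <= b <= 1 ->
  attracting_fatou_coordinate (quartic b) 0 (fatou_coordinate b).
Proof.
intros Hb; split; [| split].
- intros z Hz; destruct (fatou_coordinate_derivable b z Hb Hz) as [l Hl].
  exists l; now apply is_derive_cderiv.
- intros z Hz; now apply fatou_coordinate_abel.
- intros eps He; exists (Rmax 100 (44 / eps)); intros z Hz HM.
  pose proof (Rmax_l 100 (44 / eps)); pose proof (Rmax_r 100 (44 / eps)).
  assert (Hp : petal (- / z)%C) by (unfold petal; lra).
  pose proof (fatou_coordinate_from_petal b z 0 Hb Hp) as L; apply Clim_eq in L.
  unfold fatou_coordinate; rewrite L; simpl Nat.iter; simpl INR.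
  replace (petal_coordinate b (- / z) - 0 - (- / z - (1 - 0) * Clog (- / z)))%C with
    (petal_coordinate b (- / z) - (- / z - Clog (- / z)))%C by ring.
  eapply Rle_lt_trans; [now apply petal_coordinate_asymptotics |].
  unfold petal in Hp; apply Rmult_lt_reg_r with (Re (- / z)%C); [lra |].
  unfold Rdiv; rewrite Rmult_assoc, Rinv_l by lra.
  assert (44 / eps * eps = 44) by (field; lra).
  assert (44 / eps * eps < Re (- / z)%C * eps) by (apply Rmult_lt_compat_r; lra); lra.
Qed.

(** * The repelling Fatou parameterization *)

(** The prescribed asymptotics of the parameterization in the coordinate [- 1 / z]. *)
Definition model (Z : C) : C := (Z + Clog (- Z))%C.

Lemma left_half_plane_sqrt (Z : C) : Re Z <= - 1600 ->
  40 <= sqrt (- Re Z) /\ sqrt (- Re Z) <= sqrt (Cmod Z) /\ 1600 <= - Re Z <= Cmod Z.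
Proof.
intros HZ; pose proof (Re_ge_Cmod Z).
repeat split; try lra; [| apply sqrt_le_1_alt; lra].
rewrite <- (sqrt_pow2 40) by lra; apply sqrt_le_1_alt; lra.
Qed.

Lemma model_far (Z : C) : Re Z <= - 1600 -> - Re Z / 2 + 1 <= Cmod Z / 2 + 1 <= Cmod (model Z).
Proof.
intros HZ; destruct (left_half_plane_sqrt Z HZ) as (S1 & S2 & S3 & S4); split; [lra |].
assert (Q : sqrt (Cmod Z) * sqrt (Cmod Z) = Cmod Z) by (apply sqrt_sqrt; lra).
pose proof (Clog_growth (- Z)%C) as G; rewrite Cmod_opp in G; specialize (G ltac:(lra)).
pose proof (Cmod_sub_triangle Z (- Clog (- Z))%C) as T; rewrite Cmod_opp in T.
replace (Z - - Clog (- Z))%C with (model Z) in T by (unfold model; ring).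
nra.
Qed.

(** The term [1 / w] of the map at infinity is matched by the increment
    [Clog (- Z - 1) - Clog (- Z)]; what remains comes from replacing [1 / model Z] by
    [1 / Z], and its size [log |Z| / |Z|^2] is bounded by a summable power. *)
Lemma model_step b (Z : C) : - (1) <= b <= 1 -> Re Z <= - 1601 ->
  Cmod (at_infinity (quartic b) (model Z) - model (Z + 1))%C <= 13 / sqrt (- Re Z) ^ 3.
Proof.
intros Hb HZ.
destruct (left_half_plane_sqrt Z ltac:(lra)) as (S1 & S2 & S3 & S4).
destruct (model_far Z ltac:(lra)) as [M1 M2].
assert (Q : sqrt (Cmod Z) * sqrt (Cmod Z) = Cmod Z) by (apply sqrt_sqrt; lra).
pose proof (Clog_growth (- Z)%C) as G; rewrite Cmod_opp in G; specialize (G ltac:(lra)).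
pose proof (at_infinity_expansion b (model Z) Hb ltac:(lra)) as E.
pose proof (neq_0_of_large Z ltac:(lra)) as NZ.
pose proof (neq_0_of_large (model Z) ltac:(lra)) as NM.
pose proof (Clog_expansion (- Z)%C (- (1))%C) as L.
rewrite !Cmod_opp, Cmod_1 in L.
specialize (L ltac:(change (0 < - Re Z); lra) ltac:(change (0 < - Re Z + - (1)); lra) ltac:(lra)).
pose proof (Cmod_inv_le (model Z) (Cmod Z / 2) ltac:(lra) ltac:(lra)) as I.
replace (- Z + - (1))%C with (- (Z + 1))%C in L by ring.
set (F := at_infinity (quartic b) (model Z)) in *.
replace (F - model (Z + 1))%C with
  ((F - model Z - 1 - / model Z) - Clog (- Z) * (/ Z * / model Z)
   - (Clog (- (Z + 1)) - Clog (- Z) - - (1) / - Z))%C.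
2:{ replace (Clog (- Z) * (/ Z * / model Z))%C with (/ Z - / model Z)%C
      by (unfold model in *; field; auto).
    unfold model at 1 4; field; auto. }
set (q := sqrt (Cmod Z)) in *; set (p := sqrt (- Re Z)) in *.
apply Rle_trans with (13 / q ^ 3).
2:{ apply Rmult_le_compat_l; [lra |]; apply Rinv_le_contravar; [apply pow_lt; lra |].
    apply pow_incr; lra. }
rewrite <- Q in *.
assert (q0 : 40 <= q) by lra.
assert (I2 : Cmod (/ model Z)%C <= 2 / q ^ 2).
{ eapply Rle_trans; [apply I |]; right; field; lra. }
assert (Y1 : 3 * Cmod (/ model Z)%C ^ 2 <= 12 / q ^ 4).
{ replace (12 / q ^ 4) with (3 * (2 / q ^ 2) ^ 2) by (field; lra).
  apply Rmult_le_compat_l; [lra |]; apply pow_incr; split; auto using Cmod_ge_0. }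
assert (Y2 : Cmod (Clog (- Z) * (/ Z * / model Z))%C <= 6 * q * (/ (q * q) * (2 / q ^ 2))).
{ apply Cmod_mul_bound; auto; apply Cmod_mul_bound; auto.
  apply Cmod_inv_le; lra. }
eapply Rle_trans; [apply Cmod_sub_bound; [apply Cmod_sub_bound; [eapply Rle_trans; [apply E | apply Y1] | apply Y2] | apply L] |].
replace (12 / q ^ 4 + 6 * q * (/ (q * q) * (2 / q ^ 2)) + 4 * 1 ^ 2 / (q * q) ^ 2)
  with ((16 / q + 12) / q ^ 3) by (field; lra).
apply Rmult_le_compat_r; [left; apply Rinv_0_lt_compat, pow_lt; lra |].
assert (16 / q <= 1); [| lra].
apply Rle_div_l; lra.
Qed.

Lemma inv_sqrt_increment (x : R) : 1 < x ->
  1 / (2 * sqrt x ^ 3) <= / sqrt (x - 1) - / sqrt x.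
Proof.
intros Hx.
assert (P : 0 < sqrt (x - 1)) by (apply sqrt_lt_R0; lra).
assert (L : sqrt (x - 1) <= sqrt x) by (apply sqrt_le_1_alt; lra).
assert (Q1 : sqrt (x - 1) * sqrt (x - 1) = x - 1) by (apply sqrt_sqrt; lra).
assert (Q2 : sqrt x * sqrt x = x) by (apply sqrt_sqrt; lra).
set (p := sqrt (x - 1)) in *; set (q := sqrt x) in *.
replace (/ p - / q) with (1 / (p * q * (p + q))).
- apply Rmult_le_compat_l; [lra |]; apply Rinv_le_contravar.
  + repeat apply Rmult_lt_0_compat; lra.
  + assert (p * q <= q * q) by nra.
    replace (2 * q ^ 3) with ((q * q) * (2 * q)) by ring.
    apply Rmult_le_compat; nra.
- assert (E : 1 = (q - p) * (p + q)) by lra.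
  replace (1 / (p * q * (p + q))) with (((q - p) * (p + q)) / (p * q * (p + q)))
    by (rewrite <- E; reflexivity).
  field; lra.
Qed.

Lemma model_orbit b (Z : C) k : - (1) <= b <= 1 -> Re Z + INR k <= - 1600 ->
  Cmod (Nat.iter k (at_infinity (quartic b)) (model Z) - model (Z + INR k))%C
    <= 40 / sqrt (- (Re Z + INR k)).
Proof.
intros Hb; induction k as [| k IH]; intros HZ.
- simpl Nat.iter; simpl INR.
  replace (model Z - model (Z + 0))%C with (RtoC 0)
    by (replace (Z + 0)%C with Z by ring; ring).
  rewrite Cmod_0; apply Rlt_le, Rdiv_lt_0_compat; [lra |]; apply sqrt_lt_R0; simpl in HZ; lra.
- rewrite S_INR in HZ |- *; specialize (IH ltac:(lra)).
  rewrite Nat.iter_succ.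
  set (w := Nat.iter k (at_infinity (quartic b)) (model Z)) in *.
  set (Y := (Z + INR k)%C) in *.
  replace (Z + RtoC (INR k + 1))%C with (Y + 1)%C by (unfold Y; rewrite RtoC_plus; ring).
  assert (RY : Re Y = Re Z + INR k) by reflexivity.
  replace (- (Re Z + (INR k + 1))) with (- Re Y - 1) by lra.
  assert (HY : Re Y <= - 1601) by lra.
  rewrite <- RY in IH; clear HZ RY; clearbody w Y.
  destruct (left_half_plane_sqrt Y ltac:(lra)) as (S1 & _ & S3 & S4).
  destruct (model_far Y ltac:(lra)) as [M1 M2].
  pose proof (model_step b Y Hb HY) as St.
  pose proof (inv_sqrt_increment (- Re Y) ltac:(lra)) as Inc.
  assert (Q : sqrt (- Re Y) * sqrt (- Re Y) = - Re Y) by (apply sqrt_sqrt; lra).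
  set (q := sqrt (- Re Y)) in *.
  assert (d1 : Cmod (w - model Y)%C <= 1).
  { eapply Rle_trans; [apply IH |]; apply Rle_div_l; lra. }
  assert (Hw : - Re Y / 2 <= Cmod w).
  { pose proof (Cmod_sub_triangle (model Y) (model Y - w)%C) as T.
    replace (model Y - (model Y - w))%C with w in T by ring.
    rewrite Cmod_sub_sym in d1; lra. }
  pose proof (slope_sub_1 b w (model Y) (- Re Y / 2) Hb ltac:(lra) Hw ltac:(lra)) as Sl.
  replace (at_infinity (quartic b) w - model (Y + 1))%C with
    ((w - model Y) * (1 + (slope b w (model Y) - 1)) +
     (at_infinity (quartic b) (model Y) - model (Y + 1)))%C.
  2:{ pose proof (at_infinity_slope b w (model Y) Hb ltac:(lra) ltac:(lra)) as A.
      replace ((w - model Y) * (1 + (slope b w (model Y) - 1)))%C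
        with ((w - model Y) * slope b w (model Y))%C by ring.
      rewrite <- A; ring. }
  eapply Rle_trans.
  { apply Cmod_add_bound; [apply Cmod_mul_bound; [apply IH |] | apply St].
    apply Cmod_add_bound; [rewrite Cmod_1; apply Rle_refl | apply Sl]. }
  apply Rle_trans with (40 * (/ q + 1 / (2 * q ^ 3))).
  + rewrite <- Q.
    assert (0 < / q ^ 3) by (apply Rinv_0_lt_compat, pow_lt; lra).
    assert (/ q ^ 2 <= / 1600).
    { apply Rinv_le_contravar; [lra |]; simpl; nra. }
    replace (40 / q * (1 + 5 / (q * q / 2) ^ 2) + 13 / q ^ 3)
      with (40 * / q + / q ^ 3 * (800 * / q ^ 2 + 13)) by (field; lra).
    replace (40 * (/ q + 1 / (2 * q ^ 3))) with (40 * / q + / q ^ 3 * 20) by (field; lra).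
    apply Rplus_le_compat_l, Rmult_le_compat_l; lra.
  + unfold Rdiv at 2; apply Rmult_le_compat_l; lra.
Qed.

(** Backward version of the distortion bound: the orbits may come in from infinity, at
    index [k] being about [n - k] steps away from the half-plane where they end. *)
Lemma incoming_distortion b (v w p h : C) (X : R) (n : nat) : - (1) <= b <= 1 -> 1600 <= X ->
  (forall k, (k < n)%nat ->
     (X + (INR n - INR k)) / 2 <= Cmod (Nat.iter k (at_infinity (quartic b)) v) /\
     (X + (INR n - INR k)) / 2 <= Cmod (Nat.iter k (at_infinity (quartic b)) w)) ->
  Cmod (Nat.iter n (at_infinity (quartic b)) v - Nat.iter n (at_infinity (quartic b)) w)%C
    <= 2 * Cmod (v - w)%C /\
  Cmod (Nat.iter n (at_infinity (quartic b)) v - Nat.iter n (at_infinity (quartic b)) w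
        - iter_derivative b w n * p * h)%C
    <= 2 * Cmod (v - w - p * h)%C + 4 * Cmod (v - w)%C ^ 2.
Proof.
intros Hb HX H.
assert (K : forall k, (k <= n)%nat -> 0 <= INR n - INR k).
{ intros k Hk; apply le_INR in Hk; lra. }
assert (I : forall k, (k <= n)%nat -> / (X + (INR n - INR k)) <= / 1600).
{ intros k Hk; specialize (K k Hk); apply Rinv_le_contravar; lra. }
assert (J : 0 < / (X + INR n)) by (apply Rinv_0_lt_compat; pose proof (pos_INR n); lra).
destruct (iter_distortion b v w p h (fun k => (X + (INR n - INR k)) / 2)
  (fun k => 20 * (/ (X + (INR n - INR k)) - / (X + INR n))) n Hb) with (k := n)
  as (_ & D1 & D2); auto; cbv beta.
- intros k Hk; specialize (K k ltac:(lia)); destruct (H k Hk); repeat split; auto; lra.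
- simpl; rewrite Rminus_0_r; lra.
- intros k Hk; pose proof (K (S k) Hk) as KS; rewrite S_INR in KS |- *.
  set (y := X + (INR n - INR k)) in *.
  replace (X + (INR n - (INR k + 1))) with (y - 1) by (unfold y; ring).
  assert (Y : 1600 <= y - 1) by (unfold y; lra).
  replace (5 / (y / 2) ^ 2) with (20 * / (y * y)) by (field; lra).
  assert (/ (y * y) <= / (y - 1) - / y); [| lra].
  replace (/ (y - 1) - / y) with (/ (y * (y - 1))) by (field; lra).
  apply Rinv_le_contravar; nra.
- intros k Hk; specialize (I k Hk); lra.
- pose proof (I n ltac:(lia)) as In.
  pose proof (Cmod_ge_0 (v - w)%C) as d0; pose proof (Cmod_ge_0 (v - w - p * h)%C) as e0.
  pose proof (pow2_ge_0 (Cmod (v - w)%C)) as d2; split.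
  + eapply Rle_trans; [apply D1 |]; apply Rmult_le_compat_r; lra.
  + eapply Rle_trans; [apply D2 |]; apply Rplus_le_compat; apply Rmult_le_compat_r; lra.
Qed.

Lemma model_orbit_far b (Z : C) k : - (1) <= b <= 1 -> Re Z + INR k <= - 1600 ->
  - (Re Z + INR k) / 2 <= Cmod (Nat.iter k (at_infinity (quartic b)) (model Z)).
Proof.
intros Hb HZ; pose proof (model_orbit b Z k Hb HZ) as O.
assert (R1 : Re (Z + INR k)%C = Re Z + INR k) by reflexivity.
destruct (model_far (Z + INR k)%C ltac:(lra)) as [M1 M2].
destruct (left_half_plane_sqrt (Z + INR k)%C ltac:(lra)) as (S1 & _).
rewrite R1 in M1, S1.
assert (d1 : 40 / sqrt (- (Re Z + INR k)) <= 1) by (apply Rle_div_l; lra).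
set (w := Nat.iter k (at_infinity (quartic b)) (model Z)) in *.
pose proof (Cmod_sub_triangle (model (Z + INR k)) (model (Z + INR k) - w)%C) as T.
replace (model (Z + INR k) - (model (Z + INR k) - w))%C with w in T by ring.
rewrite Cmod_sub_sym in O; lra.
Qed.

Definition incoming (b : R) (Z : C) (n : nat) : C :=
  Nat.iter n (at_infinity (quartic b)) (model (Z - INR n)).

Lemma incoming_close_model b (Z : C) n : - (1) <= b <= 1 -> Re Z <= - 1600 ->
  Cmod (incoming b Z n - model Z)%C <= 40 / sqrt (- Re Z).
Proof.
intros Hb HZ; unfold incoming.
assert (R1 : Re (Z - INR n)%C = Re Z - INR n) by reflexivity.
pose proof (model_orbit b (Z - INR n)%C n Hb) as O; rewrite R1 in O.
replace (Re Z - INR n + INR n) with (Re Z) in O by ring.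
replace (Z - INR n + INR n)%C with Z in O by ring; auto.
Qed.

Lemma incoming_far b (Z : C) n k : - (1) <= b <= 1 -> Re Z <= - 1600 -> (k <= n)%nat ->
  (- Re Z + (INR n - INR k)) / 2 <=
    Cmod (Nat.iter k (at_infinity (quartic b)) (model (Z - INR n))).
Proof.
intros Hb HZ Hk; apply le_INR in Hk.
assert (R1 : Re (Z - INR n)%C = Re Z - INR n) by reflexivity.
pose proof (model_orbit_far b (Z - INR n)%C k Hb) as M; rewrite R1 in M.
eapply Rle_trans; [| apply M; lra]; lra.
Qed.

Lemma incoming_close b (Z : C) n m : - (1) <= b <= 1 -> Re Z <= - 1600 -> (n <= m)%nat ->
  Cmod (incoming b Z m - incoming b Z n)%C <= 80 / sqrt (- Re Z + INR n).
Proof.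
intros Hb HZ Hnm.
assert (RR : forall j, Re (Z - INR j)%C = Re Z - INR j) by reflexivity.
assert (E : incoming b Z m = Nat.iter n (at_infinity (quartic b))
              (incoming b (Z - INR n) (m - n))).
{ unfold incoming; rewrite <- Nat.iter_add; f_equal; [lia |].
  rewrite minus_INR, RtoC_minus by auto; f_equal; ring. }
pose proof (pos_INR n) as n0.
pose proof (incoming_close_model b (Z - INR n)%C (m - n) Hb) as C1.
rewrite RR in C1; specialize (C1 ltac:(lra)).
rewrite E; unfold incoming at 2.
destruct (incoming_distortion b (incoming b (Z - INR n) (m - n)) (model (Z - INR n)) 0 0
  (- Re Z) n Hb ltac:(lra)) as [D _].
- intros k Hk; split; [| apply incoming_far; auto; lia].
  pose proof (incoming_far b Z m (m - n + k) Hb HZ ltac:(lia)) as M.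
  rewrite plus_INR, minus_INR in M by auto.
  unfold incoming; rewrite <- Nat.iter_add, (Nat.add_comm k), minus_INR, RtoC_minus by auto.
  replace (Z - INR n - (INR m - INR n))%C with (Z - INR m)%C by ring.
  eapply Rle_trans; [| apply M]; lra.
- eapply Rle_trans; [apply D |].
  replace (- (Re Z - INR n)) with (- Re Z + INR n) in C1 by ring.
  unfold Rdiv in *; lra.
Qed.

Lemma small_inverse_sqrt (eps : R) : 0 < eps ->
  exists N : nat, forall n x, (N <= n)%nat -> 0 <= x -> 80 / sqrt (x + INR n) < eps.
Proof.
intros He; destruct (INR_unbounded ((80 / eps) ^ 2)) as [N HN].
exists N; intros n x Hn Hx; apply le_INR in Hn.
assert (P : 0 < 80 / eps) by (apply Rdiv_lt_0_compat; lra).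
assert (L : 80 / eps < sqrt (x + INR n)).
{ rewrite <- (sqrt_pow2 (80 / eps)) by lra; apply sqrt_lt_1_alt; split; [apply pow2_ge_0 | lra]. }
apply Rlt_div_l; [lra |].
replace 80 with (eps * (80 / eps)) by (field; lra); apply Rmult_lt_compat_l; lra.
Qed.

Lemma incoming_converges b (Z : C) : - (1) <= b <= 1 -> Re Z <= - 1600 ->
  exists l, cconv (incoming b Z) l.
Proof.
intros Hb HZ; apply cconv_cauchy; intros eps He.
destruct (small_inverse_sqrt (eps / 2)) as [N HN]; [lra |]; exists N.
assert (X : forall n, (N <= n)%nat -> Cmod (incoming b Z n - incoming b Z N)%C < eps / 2).
{ intros n Hn; eapply Rle_lt_trans; [now apply incoming_close |]; apply HN; auto; lra. }
intros n m Hn Hm; pose proof (X n Hn); pose proof (X m Hm).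
replace (incoming b Z n - incoming b Z m)%C with
  ((incoming b Z n - incoming b Z N) - (incoming b Z m - incoming b Z N))%C by ring.
eapply Rle_lt_trans; [apply Cmod_sub_le | lra].
Qed.

Definition incoming_limit (b : R) (Z : C) : C := Clim (incoming b Z).

Lemma incoming_limit_lim b (Z : C) : - (1) <= b <= 1 -> Re Z <= - 1600 ->
  cconv (incoming b Z) (incoming_limit b Z).
Proof. intros; now apply Clim_cconv, incoming_converges. Qed.

Lemma incoming_limit_asymptotics b (Z : C) : - (1) <= b <= 1 -> Re Z <= - 1600 ->
  Cmod (incoming_limit b Z - model Z)%C <= 40 / sqrt (- Re Z).
Proof.
intros Hb HZ; apply cconv_le with (incoming b Z); [| now apply incoming_limit_lim].
exists 0%nat; intros n _; now apply incoming_close_model.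
Qed.

Lemma incoming_limit_neq_0 b (Z : C) : - (1) <= b <= 1 -> Re Z <= - 1600 ->
  incoming_limit b Z <> 0%C.
Proof.
intros Hb HZ; pose proof (incoming_limit_asymptotics b Z Hb HZ) as A.
destruct (model_far Z HZ) as [M1 M2].
destruct (left_half_plane_sqrt Z HZ) as (S1 & _).
assert (d1 : 40 / sqrt (- Re Z) <= 1) by (apply Rle_div_l; lra).
apply Cmod_gt_0.
pose proof (Cmod_sub_triangle (model Z) (model Z - incoming_limit b Z)%C) as T.
replace (model Z - (model Z - incoming_limit b Z))%C with (incoming_limit b Z) in T by ring.
rewrite Cmod_sub_sym in A; lra.
Qed.

Lemma incoming_limit_derivable b (Z : C) : - (1) <= b <= 1 -> Re Z <= - 1602 ->
  exists l, cderiv (incoming_limit b) Z l.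
Proof.
intros Hb HZ.
apply (cderiv_limit (fun n x => incoming b x n) _
  (fun n => iter_derivative b (model (Z - INR n)) n * (1 + / (Z - INR n)))%C Z 18 (1 / 2)); [lra | |].
- intros h Hh; apply incoming_limit_lim; auto.
  change (Re Z + Re h <= - 1600); pose proof (Re_le_Cmod h); lra.
- intros n h Hh; pose proof (Re_le_Cmod h) as Rh; pose proof (Re_ge_Cmod h) as Rh'.
  assert (R1 : Re (Z + h)%C = Re Z + Re h) by reflexivity.
  set (Y := (Z - INR n)%C).
  assert (RY : Re Y = Re Z - INR n) by reflexivity.
  pose proof (pos_INR n) as n0.
  pose proof (Re_ge_Cmod Y) as CY.
  pose proof (neq_0_of_large Y ltac:(lra)) as NY.
  assert (L : Cmod (model (Y + h) - model Y - (1 + / Y) * h)%C <= Cmod h ^ 2).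
  { pose proof (Clog_expansion (- Y)%C (- h)%C) as L; rewrite !Cmod_opp in L.
    specialize (L ltac:(change (0 < - Re Y); lra) ltac:(change (0 < - Re Y + - Re h); lra) ltac:(lra)).
    replace (- Y + - h)%C with (- (Y + h))%C in L by ring.
    replace (model (Y + h) - model Y - (1 + / Y) * h)%C with
      (Clog (- (Y + h)) - Clog (- Y) - - h / - Y)%C by (unfold model; field; auto).
    eapply Rle_trans; [apply L |]; apply Rle_div_l; [apply pow_lt; lra |].
    pose proof (pow2_ge_0 (Cmod h)).
    assert (4 <= Cmod Y ^ 2) by (simpl; nra); nra. }
  assert (L1 : Cmod (model (Y + h) - model Y)%C <= 2 * Cmod h).
  { replace (model (Y + h) - model Y)%C with
      ((model (Y + h) - model Y - (1 + / Y) * h) + (1 + / Y) * h)%C by ring.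
    pose proof (Cmod_inv_le Y 1600 ltac:(lra) ltac:(lra)) as IY.
    pose proof (Cmod_ge_0 h).
    eapply Rle_trans.
    - apply Cmod_add_bound; [apply L |]; apply Cmod_mul_bound; [| apply Rle_refl].
      apply Cmod_add_bound; [rewrite Cmod_1; apply Rle_refl | apply IY].
    - simpl; nra. }
  destruct (incoming_distortion b (model (Y + h)) (model Y) (1 + / Y) h
    (- Re Z - 1) n Hb ltac:(lra)) as [_ D].
  + intros k Hk; unfold Y.
    pose proof (incoming_far b (Z + h)%C n k Hb ltac:(lra) ltac:(lia)) as M1.
    pose proof (incoming_far b Z n k Hb ltac:(lra) ltac:(lia)) as M2.
    replace (Z + h - INR n)%C with (Z - INR n + h)%C in M1 by ring.
    split; eapply Rle_trans; [| apply M1 | | apply M2]; lra.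
  + unfold incoming.
    replace (Z + h - INR n)%C with (Y + h)%C by (unfold Y; ring); fold Y.
    eapply Rle_trans; [apply D |].
    pose proof (Cmod_ge_0 (model (Y + h) - model Y)%C).
    assert (Cmod (model (Y + h) - model Y)%C ^ 2 <= (2 * Cmod h) ^ 2) by (apply pow_incr; lra).
    simpl in *; lra.
Qed.

(** As for the attracting coordinate, a limit: the functional equation is a shift of
    indices, and the limit exists on the whole plane because [f] is entire. *)
Definition fatou_parameterization (b : R) (Z : C) : C :=
  Clim (fun n => Nat.iter n (quartic b) (- / model (Z - INR n))%C).

Lemma fatou_parameterization_from_left b (Z : C) N : - (1) <= b <= 1 ->
  Re Z - INR N <= - 1600 ->
  cconv (fun n => Nat.iter n (quartic b) (- / model (Z - INR n))%C)
    (Nat.iter N (quartic b) (- / incoming_limit b (Z - INR N))%C).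
Proof.
intros Hb HZ; apply (cconv_shift _ _ N).
assert (HZ' : Re (Z - INR N)%C <= - 1600) by exact HZ.
pose proof (incoming_limit_lim b _ Hb HZ') as L.
pose proof (cderiv_opp_inv _ (incoming_limit_neq_0 b _ Hb HZ')) as D1.
destruct (cderiv_iter_quartic b N (- / incoming_limit b (Z - INR N))%C) as [l2 D2].
pose proof (cconv_map _ _ _ _ D2 (cconv_map (fun x => - / x)%C _ _ _ D1 L)) as L2.
refine (cconv_ext _ _ _ _ L2); exists 0%nat; intros n _; cbv beta.
unfold incoming; rewrite <- iter_of_infinity, <- Nat.iter_add, (Nat.add_comm N), plus_INR, RtoC_plus.
now replace (Z - INR N - INR n)%C with (Z - (INR n + INR N))%C by ring.
Qed.

Lemma left_translate (x : R) : exists N, x - INR N <= - 1602.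
Proof. destruct (INR_unbounded (x + 1602)) as [N HN]; exists N; lra. Qed.

Lemma fatou_parameterization_eq b (Z : C) N : - (1) <= b <= 1 -> Re Z - INR N <= - 1600 ->
  fatou_parameterization b Z = Nat.iter N (quartic b) (- / incoming_limit b (Z - INR N))%C.
Proof. intros; now apply Clim_eq, fatou_parameterization_from_left. Qed.

Lemma fatou_parameterization_derivable b (Z : C) : - (1) <= b <= 1 ->
  exists l, cderiv (fatou_parameterization b) Z l.
Proof.
intros Hb; destruct (left_translate (Re Z)) as [N HN].
assert (HZ : Re (Z - INR N)%C <= - 1602) by exact HN.
destruct (incoming_limit_derivable b _ Hb HZ) as [l1 D1].
pose proof (cderiv_translate (- INR N)%C Z) as D0.
pose proof (cderiv_comp (incoming_limit b) (fun x => x + - INR N)%C Z _ _ D0 D1) as D2.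
pose proof (cderiv_opp_inv _ (incoming_limit_neq_0 b _ Hb (Rle_trans _ (- 1602) (- 1600) HZ ltac:(lra)))) as D3.
pose proof (cderiv_comp (fun x => - / x)%C _ _ _ _ D2 D3) as D4; cbv beta in D4.
destruct (cderiv_iter_quartic b N (- / incoming_limit b (Z - INR N))%C) as [l5 D5].
pose proof (cderiv_comp _ _ _ _ _ D4 D5) as D6; cbv beta in D6.
eexists; refine (cderiv_ext_loc _ _ _ _ 1 Rlt_0_1 _ D6); intros h Hh.
symmetry; apply fatou_parameterization_eq; auto.
change (Re Z + Re h - INR N <= - 1600); pose proof (Re_le_Cmod h); lra.
Qed.

Lemma fatou_parameterization_step b (Z : C) : - (1) <= b <= 1 ->
  fatou_parameterization b (Z + 1) = quartic b (fatou_parameterization b Z).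
Proof.
intros Hb; destruct (left_translate (Re Z)) as [N HN].
rewrite (fatou_parameterization_eq b Z N Hb) by lra.
rewrite (fatou_parameterization_eq b (Z + 1) (S N) Hb).
- rewrite S_INR, RtoC_plus, Nat.iter_succ.
  now replace (Z + 1 - (INR N + 1))%C with (Z - INR N)%C by ring.
- rewrite S_INR; change (Re Z + 1 - (INR N + 1) <= - 1600); lra.
Qed.

Theorem fatou_parameterization_repelling b : - (1) <= b <= 1 ->
  repelling_fatou_parameterization (quartic b) 0 (fatou_parameterization b).
Proof.
intros Hb; split; [| split].
- intros Z; destruct (fatou_parameterization_derivable b Z Hb) as [l Hl].
  exists l; now apply is_derive_cderiv.
- intros Z; now apply fatou_parameterization_step.
- intros eps He; exists (Rmin (- 1600) (- (80 / eps) ^ 2)); intros Z HZ.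
  pose proof (Rmin_l (- 1600) (- (80 / eps) ^ 2)); pose proof (Rmin_r (- 1600) (- (80 / eps) ^ 2)).
  rewrite (fatou_parameterization_eq b Z 0 Hb) by (simpl; lra); simpl Nat.iter; simpl INR.
  replace (Z - 0)%C with Z by ring.
  rewrite Copp_inv, Cinv_involutive.
  replace (- - incoming_limit b Z - (Z + (1 - 0) * Clog (- Z)))%C with
    (incoming_limit b Z - model Z)%C by (unfold model; ring).
  eapply Rle_lt_trans; [apply incoming_limit_asymptotics; auto; lra |].
  assert (P : 0 < 80 / eps) by (apply Rdiv_lt_0_compat; lra).
  assert (L : 80 / eps < sqrt (- Re Z)).
  { rewrite <- (sqrt_pow2 (80 / eps)) by lra; apply sqrt_lt_1_alt; split; [apply pow2_ge_0 | lra]. }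
  apply Rlt_div_l; [lra |].
  assert (eps * (80 / eps) < eps * sqrt (- Re Z)) by (apply Rmult_lt_compat_l; lra).
  replace (eps * (80 / eps)) with 80 in * by (field; lra); lra.
Qed.

(** Push the orbit [W] and the model with phase [x] forward by the same number of steps:
    their distance at a far index controls their distance at a fixed index, and it tends
    to [0].  The linear growth of [W] is what the distortion bound needs. *)
Lemma fatou_parameterization_value b (x : R) (W : nat -> C) (K : R) : - (1) <= b <= 1 ->
  (forall n, at_infinity (quartic b) (W (S n)) = W n) ->
  (forall n, (INR n - K) / 2 <= Cmod (W n)) ->
  cconv (fun n => W n - model (RtoC x - INR n))%C 0 ->
  fatou_parameterization b (RtoC x) = (- / W 0%nat)%C.
Proof.
intros Hb HW Hfar Hlim.
assert (It : forall k n, Nat.iter k (at_infinity (quartic b)) (W (n + k)%nat) = W n).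
{ induction k as [| k IH]; intros n; [now rewrite Nat.add_0_r |].
  rewrite Nat.iter_succ_r, Nat.add_succ_r, HW; apply IH. }
destruct (INR_unbounded (Rabs K + Rabs x + 1600)) as [j Hj].
pose proof (Rle_abs K) as K1; pose proof (Rle_abs x) as x1.
pose proof (Rabs_pos x); pose proof (Rabs_pos K).
assert (Hx : Re (RtoC x - INR j)%C <= - 1600) by (change (x - INR j <= - 1600); lra).
rewrite (fatou_parameterization_eq b _ j Hb) by exact Hx.
rewrite <- (It j 0%nat), Nat.add_0_l, <- iter_of_infinity.
do 2 f_equal; f_equal.
apply (cconv_unique (incoming b (RtoC x - INR j))); [now apply incoming_limit_lim |].
intros eps He; destruct (Hlim (eps / 2)) as [N HN]; [lra |].
exists N; intros n Hn; specialize (HN (j + n)%nat ltac:(lia)).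
rewrite plus_INR, RtoC_plus in HN.
replace (RtoC x - (INR j + INR n))%C with (RtoC x - INR j - INR n)%C in HN by ring.
replace (W (j + n)%nat - model (RtoC x - INR j - INR n) - 0)%C
  with (W (j + n)%nat - model (RtoC x - INR j - INR n))%C in HN by ring.
unfold incoming; rewrite Cmod_sub_sym, <- (It n j).
destruct (incoming_distortion b (W (j + n)%nat) (model (RtoC x - INR j - INR n)) 0 0
  1600 n Hb ltac:(lra)) as [D _]; [| lra].
intros k Hk; split.
- replace (j + n)%nat with ((j + n - k) + k)%nat by lia; rewrite It.
  eapply Rle_trans; [| apply Hfar]; rewrite minus_INR, plus_INR by lia.
  lra.
- eapply Rle_trans; [| apply incoming_far; auto; lia]; lra.
Qed.

(** * Real orbits of the critical point *)

Definition real_quartic (b z : R) : R := z + z ^ 2 + b * z ^ 4.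

Lemma quartic_RtoC b z : quartic b (RtoC z) = RtoC (real_quartic b z).
Proof.
unfold quartic, real_quartic; rewrite !RtoC_plus, RtoC_mult, !RtoC_pow; reflexivity.
Qed.

Lemma iter_quartic_RtoC b z n :
  Nat.iter n (quartic b) (RtoC z) = RtoC (Nat.iter n (real_quartic b) z).
Proof. induction n as [| n IH]; simpl; auto; rewrite IH; apply quartic_RtoC. Qed.

(** Approximate Abel coordinate, valid on both sides of [0]: it is [w - log w] for
    [w = - 1 / z] when [z < 0] and an approximate inverse of the model when [z > 0]. *)
Definition log_coordinate (z : R) : R := - / z + ln (Rabs z).

(** The defect of [log_coordinate] in the Abel equation. *)
Definition abel_defect (b z : R) : R :=
  (1 + b * z ^ 2) / (1 + z * (1 + b * z ^ 2)) - 1 + ln (1 + z * (1 + b * z ^ 2)).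

Lemma real_quartic_factor b z : real_quartic b z = z * (1 + z * (1 + b * z ^ 2)).
Proof. unfold real_quartic; ring. Qed.

Lemma log_coordinate_step b z : z <> 0 -> 0 < 1 + z * (1 + b * z ^ 2) ->
  log_coordinate (real_quartic b z) = log_coordinate z + 1 + abel_defect b z.
Proof.
intros Hz Hm; rewrite real_quartic_factor; unfold log_coordinate, abel_defect.
rewrite Rabs_mult, (Rabs_pos_eq (1 + z * (1 + b * z ^ 2))), ln_mult by
  (try apply Rabs_pos_lt; lra).
set (T := 1 + b * z ^ 2) in *.
assert (E : - / (z * (1 + z * T)) = - / z + T / (1 + z * T)) by (field; lra); lra.
Qed.

Lemma ln_le_sub_1 x : 0 < x -> ln x <= x - 1.
Proof. intros Hx; pose proof (exp_ineq1_le (ln x)) as E; rewrite exp_ln in E; lra. Qed.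

Lemma ln_ge_1_sub_inv x : 0 < x -> 1 - / x <= ln x.
Proof.
intros Hx; pose proof (ln_le_sub_1 (/ x) (Rinv_0_lt_compat _ Hx)) as E.
rewrite ln_Rinv in E by auto; lra.
Qed.

Lemma abel_defect_upper b z : 0 < 1 + z * (1 + b * z ^ 2) ->
  abel_defect b z <= z ^ 2 * (b + (1 + b * z ^ 2) ^ 2) / (1 + z * (1 + b * z ^ 2)).
Proof.
intros Hm; unfold abel_defect; pose proof (ln_le_sub_1 _ Hm) as L.
replace (z ^ 2 * (b + (1 + b * z ^ 2) ^ 2) / (1 + z * (1 + b * z ^ 2))) with
  ((1 + b * z ^ 2) / (1 + z * (1 + b * z ^ 2)) - 1 + (z * (1 + b * z ^ 2)))
  by (field; lra); lra.
Qed.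

Lemma abel_defect_lower b z : 0 < 1 + z * (1 + b * z ^ 2) ->
  b * z ^ 2 / (1 + z * (1 + b * z ^ 2)) <= abel_defect b z.
Proof.
intros Hm; unfold abel_defect; pose proof (ln_ge_1_sub_inv _ Hm) as L.
replace (b * z ^ 2 / (1 + z * (1 + b * z ^ 2))) with
  ((1 + b * z ^ 2) / (1 + z * (1 + b * z ^ 2)) - / (1 + z * (1 + b * z ^ 2)))
  by (field; lra); lra.
Qed.

Lemma abel_defect_bound b z : - (1) <= b <= 0 -> 0 <= 1 + b * z ^ 2 ->
  0 < 1 + z * (1 + b * z ^ 2) ->
  Rabs (abel_defect b z) <= z ^ 2 / (1 + z * (1 + b * z ^ 2)).
Proof.
intros Hb HT Hm; pose proof (abel_defect_upper b z Hm) as U.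
pose proof (abel_defect_lower b z Hm) as L; pose proof (pow2_ge_0 z) as z2.
pose proof (Rinv_0_lt_compat _ Hm) as I.
assert (T0 : 1 + b * z ^ 2 <= 1) by nra.
assert (T1 : (1 + b * z ^ 2) ^ 2 <= 1) by (rewrite <- (pow1 2); apply pow_incr; lra).
set (m := 1 + z * (1 + b * z ^ 2)) in *; set (T := 1 + b * z ^ 2) in *.
apply Rabs_le; split.
- eapply Rle_trans; [| apply L]; unfold Rdiv.
  replace (- (z ^ 2 * / m)) with (- z ^ 2 * / m) by ring.
  apply Rmult_le_compat_r; nra.
- eapply Rle_trans; [apply U |]; unfold Rdiv; apply Rmult_le_compat_r; [lra |].
  rewrite <- (Rmult_1_r (z ^ 2)) at 2; apply Rmult_le_compat_l; lra.
Qed.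

(** ** Forward orbits *)

Definition param_range (b : R) : Prop := - 8 / 27 <= b <= - 239 / 1000.

Lemma forward_step b z : param_range b -> - 8 / 5 <= z < 0 ->
  1 / 5 <= 1 + z * (1 + b * z ^ 2) <= 1 /\ 6 / 25 <= 1 + b * z ^ 2 <= 1 /\
  real_quartic b z - z = z ^ 2 * (1 + b * z ^ 2) /\ z <= real_quartic b z < 0.
Proof.
intros [b1 b2] [z1 z2]; rewrite real_quartic_factor.
assert (S : 0 <= z ^ 2 <= 64 / 25) by (split; [apply pow2_ge_0 | nra]).
assert (T : 6 / 25 <= 1 + b * z ^ 2 <= 1) by nra.
assert (M1 : z * (1 + b * z ^ 2) <= 0) by nra.
assert (M2 : 1 / 5 <= 1 + z * (1 + b * z ^ 2)).
{ (* [y - 0.239 y^3] is maximal near [y = 1.18] *)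
  assert (C : 0 <= (- z - 118 / 100) ^ 2 * (- z + 236 / 100))
    by (apply Rmult_le_pos; [apply pow2_ge_0 | lra]).
  assert (B : b * z ^ 3 >= - 239 / 1000 * z ^ 3).
  { assert (z ^ 3 <= 0) by (simpl; nra); nra. }
  replace (1 + z * (1 + b * z ^ 2)) with (1 + z + b * z ^ 3) by ring.
  nra. }
repeat split; try lra; try ring; nra.
Qed.

Lemma forward_coordinate b z : param_range b -> - 8 / 5 <= z < 0 ->
  log_coordinate (real_quartic b z) = log_coordinate z + 1 + abel_defect b z /\
  Rabs (abel_defect b z) <= 25 * (real_quartic b z - z) /\
  6 / 25 - / z <= - / real_quartic b z.
Proof.
intros Hb Hz; destruct (forward_step b z Hb Hz) as (M & T & D & _).
destruct Hb as [b1 b2]; repeat split.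
- apply log_coordinate_step; lra.
- eapply Rle_trans; [apply abel_defect_bound; lra |].
  rewrite D; apply Rle_div_l; [lra |].
  set (m := 1 + z * (1 + b * z ^ 2)) in *; pose proof (pow2_ge_0 z) as z2.
  assert (X : 1 <= 25 * (1 + b * z ^ 2) * m) by nra.
  apply Rle_trans with (z ^ 2 * (25 * (1 + b * z ^ 2) * m)); [| right; ring].
  rewrite <- (Rmult_1_r (z ^ 2)) at 1; apply Rmult_le_compat_l; lra.
- rewrite real_quartic_factor.
  set (U := 1 + b * z ^ 2) in *.
  replace (- / (z * (1 + z * U))) with (- / z + U / (1 + z * U)) by (field; lra).
  assert (6 / 25 <= U / (1 + z * U)); [| lra].
  apply (Rle_div_r (6 / 25)); lra.
Qed.

Lemma forward_orbit b z n : param_range b -> - 8 / 5 <= z < 0 ->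
  - 8 / 5 <= Nat.iter n (real_quartic b) z < 0 /\
  - / z + 6 / 25 * INR n <= - / Nat.iter n (real_quartic b) z.
Proof.
intros Hb Hz; induction n as [| n [I1 I2]].
- simpl; lra.
- rewrite Nat.iter_succ, S_INR.
  destruct (forward_step b _ Hb I1) as (_ & _ & _ & S).
  destruct (forward_coordinate b _ Hb I1) as (_ & _ & S2).
  split; lra.
Qed.

Lemma real_telescoping (u tau : nat -> R) n :
  (forall k, (n <= k)%nat -> Rabs (u (S k) - u k) <= tau k - tau (S k)) ->
  forall m, (n <= m)%nat -> Rabs (u m - u n) <= tau n - tau m.
Proof.
intros H m Hm; induction Hm as [| m Hm IH].
- rewrite Rminus_diag, Rabs_R0; lra.
- replace (u (S m) - u n) with ((u (S m) - u m) + (u m - u n)) by ring.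
  eapply Rle_trans; [apply Rabs_triang |]; specialize (H m Hm); lra.
Qed.

Definition forward_phase (b z : R) (n : nat) : R :=
  log_coordinate (Nat.iter n (real_quartic b) z) - INR n.

Lemma forward_phase_close b z n m : param_range b -> - 8 / 5 <= z < 0 -> (n <= m)%nat ->
  Rabs (forward_phase b z m - forward_phase b z n) <= 25 * - Nat.iter n (real_quartic b) z.
Proof.
intros Hb Hz Hnm.
eapply Rle_trans.
- apply (real_telescoping (forward_phase b z)
    (fun k => 25 * - Nat.iter k (real_quartic b) z) n); auto.
  intros k _; destruct (forward_orbit b z k Hb Hz) as [O _].
  destruct (forward_coordinate b _ Hb O) as (E & B & _).
  unfold forward_phase; rewrite Nat.iter_succ, E, S_INR.
  set (w := Nat.iter k (real_quartic b) z) in *.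
  replace (log_coordinate w + 1 + abel_defect b w - (INR k + 1) - (log_coordinate w - INR k))
    with (abel_defect b w) by ring; lra.
- destruct (forward_orbit b z m Hb Hz) as [O _]; lra.
Qed.

Lemma forward_orbit_small b z n : param_range b -> - 8 / 5 <= z < 0 ->
  - Nat.iter n (real_quartic b) z <= / (5 / 8 + 6 / 25 * INR n).
Proof.
intros Hb Hz; destruct (forward_orbit b z n Hb Hz) as [O P].
assert (I : 5 / 8 <= - / z).
{ replace (5 / 8) with (/ (8 / 5)) by field; rewrite <- Rinv_opp.
  apply Rinv_le_contravar; lra. }
pose proof (pos_INR n).
rewrite <- (Rinv_inv (- Nat.iter n (real_quartic b) z)); apply Rinv_le_contravar; [lra |].
rewrite Rinv_opp; lra.
Qed.

(** ** Backward orbits *)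

Lemma real_quartic_continuous b : continuity (real_quartic b).
Proof. intro x; unfold real_quartic; reg. Qed.

(** The inverse branch on [[0, 1]], which fixes the parabolic point. *)
Definition preimage (b y : R) : R :=
  epsilon (inhabits 0) (fun z => 0 <= z <= 1 /\ real_quartic b z = y).

Lemma preimage_spec b y : - 8 / 27 <= b <= 0 -> 0 <= y <= 33 / 20 ->
  0 <= preimage b y <= 1 /\ real_quartic b (preimage b y) = y.
Proof.
intros Hb Hy; unfold preimage; apply epsilon_spec.
destruct (IVT_gen (real_quartic b) 0 1 y) as (z & Hz & E).
- apply real_quartic_continuous.
- unfold real_quartic; rewrite Rmin_left, Rmax_right by lra; lra.
- rewrite Rmin_left, Rmax_right in Hz by lra; exists z; split; auto.
Qed.

(** On [[0, 1]] the map expands distances, so its inverse branch is Lipschitz, jointly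
    in the point and in the parameter. *)
Lemma real_quartic_expands b b' z z' : - 8 / 27 <= b <= 0 ->
  0 <= z <= 1 -> 0 <= z' <= 1 ->
  Rabs (z - z') <= Rabs (real_quartic b z - real_quartic b' z') + Rabs (b - b').
Proof.
intros Hb Hz Hz'.
assert (A : Rabs (z - z') <= Rabs (real_quartic b z - real_quartic b z')).
{ replace (real_quartic b z - real_quartic b z')
    with ((z - z') * (1 + (z + z') * (1 + b * (z ^ 2 + z' ^ 2))))
    by (unfold real_quartic; ring).
  rewrite Rabs_mult; rewrite <- (Rmult_1_r (Rabs (z - z'))) at 1.
  apply Rmult_le_compat_l; [apply Rabs_pos |].
  assert (0 <= z ^ 2 + z' ^ 2 <= 2) by nra.
  assert (0 <= 1 + b * (z ^ 2 + z' ^ 2)) by nra.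
  rewrite Rabs_pos_eq; nra. }
replace (real_quartic b z - real_quartic b z') with
  ((real_quartic b z - real_quartic b' z') + (b' - b) * z' ^ 4) in A
  by (unfold real_quartic; ring).
eapply Rle_trans; [apply A |]; eapply Rle_trans; [apply Rabs_triang |].
apply Rplus_le_compat_l; rewrite Rabs_mult, (Rabs_minus_sym b').
rewrite <- (Rmult_1_r (Rabs (b - b'))) at 2.
apply Rmult_le_compat_l; [apply Rabs_pos |].
rewrite Rabs_pos_eq by (apply pow_le; lra).
rewrite <- (pow1 4); apply pow_incr; lra.
Qed.

Lemma backward_step b z : - 8 / 27 <= b <= 0 -> 0 < z <= 1 ->
  1 <= 1 + z * (1 + b * z ^ 2) <= 2 /\ 7 / 10 <= 1 + b * z ^ 2 <= 1 /\
  real_quartic b z - z = z ^ 2 * (1 + b * z ^ 2) /\ z < real_quartic b z.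
Proof.
intros Hb Hz; rewrite real_quartic_factor.
assert (S : 0 < z ^ 2 <= 1) by (split; [apply pow_lt; lra | nra]).
assert (T : 7 / 10 <= 1 + b * z ^ 2 <= 1) by nra.
repeat split; try lra; try ring; nra.
Qed.

Lemma backward_coordinate b z : - 8 / 27 <= b <= 0 -> 0 < z <= 1 ->
  log_coordinate (real_quartic b z) = log_coordinate z + 1 + abel_defect b z /\
  Rabs (abel_defect b z) <= 2 * (real_quartic b z - z) /\
  abel_defect b z <= real_quartic b z - z /\
  / real_quartic b z + 7 / 20 <= / z.
Proof.
intros Hb Hz; destruct (backward_step b z Hb Hz) as (M & T & D & _).
pose proof (pow2_ge_0 z) as z2; repeat split.
- apply log_coordinate_step; lra.
- eapply Rle_trans; [apply abel_defect_bound; lra |].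
  rewrite D; apply Rle_div_l; [lra |].
  set (m := 1 + z * (1 + b * z ^ 2)) in *.
  assert (X : 1 <= 2 * (1 + b * z ^ 2) * m) by nra.
  apply Rle_trans with (z ^ 2 * (2 * (1 + b * z ^ 2) * m)); [| right; ring].
  rewrite <- (Rmult_1_r (z ^ 2)) at 1; apply Rmult_le_compat_l; lra.
- eapply Rle_trans; [apply abel_defect_upper; lra |].
  rewrite D; apply Rle_div_l; [lra |].
  set (m := 1 + z * (1 + b * z ^ 2)) in *; set (U := 1 + b * z ^ 2) in *.
  rewrite Rmult_assoc; apply Rmult_le_compat_l; auto; nra.
- rewrite real_quartic_factor.
  set (U := 1 + b * z ^ 2) in *.
  replace (/ (z * (1 + z * U))) with (/ z - U / (1 + z * U)) by (field; lra).
  assert (7 / 20 <= U / (1 + z * U)); [| lra].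
  apply (Rle_div_r (7 / 20)); lra.
Qed.

Fixpoint backward_orbit (b y : R) (n : nat) : R :=
  match n with O => y | S k => preimage b (backward_orbit b y k) end.

Lemma backward_orbit_range b y n : - 8 / 27 <= b <= 0 -> 0 < y <= 33 / 20 ->
  0 < backward_orbit b y n <= 33 / 20 /\ 0 < backward_orbit b y (S n) <= 1 /\
  real_quartic b (backward_orbit b y (S n)) = backward_orbit b y n.
Proof.
intros Hb Hy.
assert (P : forall x, 0 < x <= 33 / 20 ->
  0 < preimage b x <= 1 /\ real_quartic b (preimage b x) = x).
{ intros x Hx; destruct (preimage_spec b x Hb ltac:(lra)) as [P E]; repeat split; try lra.
  destruct (Rle_lt_or_eq_dec 0 (preimage b x) (proj1 P)) as [L | L]; auto.
  rewrite <- L in E; unfold real_quartic in E; lra. }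
induction n as [| n (I1 & I2 & I3)].
- split; auto; apply P, Hy.
- split; [lra |]; apply P; simpl in *; lra.
Qed.

Lemma backward_orbit_small b y n : - 8 / 27 <= b <= 0 -> 0 < y <= 33 / 20 ->
  / y + 7 / 20 * INR n <= / backward_orbit b y n.
Proof.
intros Hb Hy; induction n as [| n IH]; [simpl; lra |].
destruct (backward_orbit_range b y n Hb Hy) as (R1 & R2 & E).
destruct (backward_coordinate b _ Hb R2) as (_ & _ & _ & S); rewrite E in S.
rewrite S_INR; lra.
Qed.

Definition backward_phase (b y : R) (n : nat) : R :=
  log_coordinate (backward_orbit b y n) + INR n.

Lemma backward_phase_step b y n : - 8 / 27 <= b <= 0 -> 0 < y <= 33 / 20 ->
  backward_phase b y n - backward_phase b y (S n) = abel_defect b (backward_orbit b y (S n)) /\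
  Rabs (abel_defect b (backward_orbit b y (S n)))
    <= 2 * (backward_orbit b y n - backward_orbit b y (S n)) /\
  abel_defect b (backward_orbit b y (S n)) <= backward_orbit b y n - backward_orbit b y (S n).
Proof.
intros Hb Hy; destruct (backward_orbit_range b y n Hb Hy) as (R1 & R2 & E).
destruct (backward_coordinate b _ Hb R2) as (L & A & U & _); rewrite E in L, A, U.
repeat split; auto; unfold backward_phase; rewrite L, S_INR; ring.
Qed.

Lemma backward_phase_close b y n m : - 8 / 27 <= b <= 0 -> 0 < y <= 33 / 20 -> (n <= m)%nat ->
  Rabs (backward_phase b y m - backward_phase b y n) <= 2 * backward_orbit b y n.
Proof.
intros Hb Hy Hnm; eapply Rle_trans.
- apply (real_telescoping (backward_phase b y) (fun k => 2 * backward_orbit b y k) n); auto.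
  intros k _; destruct (backward_phase_step b y k Hb Hy) as (E & A & _).
  rewrite Rabs_minus_sym, E; lra.
- destruct (backward_orbit_range b y m Hb Hy) as [O _]; lra.
Qed.

(** * The one-parameter family, indexed by its critical point *)

(** The parameter for which the positive critical point of the quartic is [c]. *)
Definition critical_parameter (c : R) : R := - (1 + 2 * c) / (4 * c ^ 3).

Definition second_image (c : R) : R :=
  real_quartic (critical_parameter c) (real_quartic (critical_parameter c) c).

Lemma critical_parameter_eq c : 0 < c -> 1 + 2 * c + 4 * critical_parameter c * c ^ 3 = 0.
Proof. intros Hc; unfold critical_parameter; field; lra. Qed.

Lemma critical_parameter_range c : 3 / 2 <= c <= 33 / 20 ->
  param_range (critical_parameter c).
Proof.
intros Hc; assert (P : 0 < c ^ 3) by (apply pow_lt; lra).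
pose proof (critical_parameter_eq c ltac:(lra)) as E.
assert (Q1 : 27 * (1 + 2 * c) <= 32 * c ^ 3).
{ assert (0 <= (c - 3 / 2) * (32 * c ^ 2 + 48 * c + 18)) by (apply Rmult_le_pos; nra). nra. }
assert (Q2 : 956 / 1000 * c ^ 3 <= 1 + 2 * c).
{ assert (0 <= (33 / 20 - c) * (956 / 1000 * (c ^ 2 + 33 / 20 * c + 1089 / 400) - 2))
    by (apply Rmult_le_pos; nra). nra. }
split; apply Rmult_le_reg_r with (4 * c ^ 3); nra.
Qed.

Lemma critical_parameter_gt c : 3 / 2 < c <= 33 / 20 -> - 8 / 27 < critical_parameter c.
Proof.
intros Hc; assert (P : 0 < c ^ 3) by (apply pow_lt; lra).
pose proof (critical_parameter_eq c ltac:(lra)) as E.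
assert (Q1 : 0 < (c - 3 / 2) * (32 * c ^ 2 + 48 * c + 18)) by (apply Rmult_lt_0_compat; nra).
apply Rmult_lt_reg_r with (4 * c ^ 3); nra.
Qed.

Lemma critical_value c : 0 < c ->
  real_quartic (critical_parameter c) c = c * (3 + 2 * c) / 4.
Proof. intros Hc; unfold real_quartic, critical_parameter; field; lra. Qed.

Lemma second_image_range c : 3 / 2 <= c <= 33 / 20 -> - 8 / 5 <= second_image c <= - 9 / 32.
Proof.
intros Hc; unfold second_image; rewrite critical_value by lra.
(* expansion at [c = 3 / 2], where all coefficients have the same sign *)
set (e := c - 3 / 2).
replace (real_quartic (critical_parameter c) (c * (3 + 2 * c) / 4)) with
  (- (9 / 32 + 423 / 64 * e + 371 / 32 * e ^ 2 + 261 / 32 * e ^ 3 + 91 / 32 * e ^ 4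
      + 31 / 64 * e ^ 5 + 1 / 32 * e ^ 6))
  by (unfold e, real_quartic, critical_parameter; field; lra).
assert (He : 0 <= e <= 3 / 20) by (unfold e; lra).
assert (P : forall n, 0 <= e ^ n <= (3 / 20) ^ n).
{ intro n; split; [apply pow_le; lra | apply pow_incr; lra]. }
pose proof (P 2%nat); pose proof (P 3%nat); pose proof (P 4%nat); pose proof (P 5%nat);
  pose proof (P 6%nat); lra.
Qed.

(** ** Estimates at the two ends of the interval *)

Lemma ln_lower x : 1 <= x -> 2 * (x - 1) / (x + 1) <= ln x.
Proof.
intros Hx.
destruct (MVT_gen (fun t => ln t - 2 * (t - 1) / (t + 1)) 1 x
  (fun t => (t - 1) ^ 2 / (t * (t + 1) ^ 2))) as (y & Hy & E).
- rewrite Rmin_left, Rmax_right by lra; intros t Ht; auto_derive; [lra | field; lra].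
- rewrite Rmin_left, Rmax_right by lra; intros t Ht.
  apply derivable_continuous_pt, ex_derive_Reals_0; auto_derive; lra.
- rewrite Rmin_left, Rmax_right in Hy by lra; rewrite ln_1 in E.
  assert (0 <= (y - 1) ^ 2 / (y * (y + 1) ^ 2) * (x - 1)).
  { apply Rmult_le_pos; [| lra]; apply Rmult_le_pos; [apply pow2_ge_0 |].
    left; apply Rinv_0_lt_compat, Rmult_lt_0_compat; [lra | apply pow_lt; lra]. }
  replace (2 * (1 - 1) / (1 + 1)) with 0 in E by field; lra.
Qed.

Lemma real_quartic_reflects_le b p q : - 8 / 27 <= b <= 0 -> 0 <= p <= 1 -> 0 <= q <= 1 ->
  real_quartic b p <= real_quartic b q -> p <= q.
Proof.
intros Hb Hp Hq H; apply Rnot_lt_le; intros L.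
assert (0 <= p ^ 2 + q ^ 2 <= 2) by nra.
assert (0 <= 1 + b * (p ^ 2 + q ^ 2)) by nra.
assert (0 < (p - q) * (1 + (p + q) * (1 + b * (p ^ 2 + q ^ 2)))).
{ apply Rmult_lt_0_compat; nra. }
unfold real_quartic in H; nra.
Qed.

Lemma forward_phase_step b z n : param_range b -> - 8 / 5 <= z < 0 ->
  forward_phase b z (S n) =
    forward_phase b z n + abel_defect b (Nat.iter n (real_quartic b) z).
Proof.
intros Hb Hz; destruct (forward_orbit b z n Hb Hz) as [O _].
destruct (forward_coordinate b _ Hb O) as (E & _ & _).
unfold forward_phase; rewrite Nat.iter_succ, E, S_INR; ring.
Qed.

Lemma forward_orbit_increasing b z n k : param_range b -> - 8 / 5 <= z < 0 ->
  Nat.iter n (real_quartic b) z <= Nat.iter (n + k) (real_quartic b) z.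
Proof.
intros Hb Hz; induction k as [| k IH]; [rewrite Nat.add_0_r; lra |].
rewrite Nat.add_succ_r, Nat.iter_succ.
destruct (forward_orbit b z (n + k) Hb Hz) as [O _].
destruct (forward_step b _ Hb O) as (_ & _ & _ & S); lra.
Qed.

Lemma forward_phase_at_left_end n :
  2 + 3 / 100 <= forward_phase (critical_parameter (3 / 2)) (second_image (3 / 2)) n.
Proof.
pose proof (critical_parameter_range (3 / 2) ltac:(lra)) as Hb.
assert (Et : second_image (3 / 2) = - 9 / 32).
{ unfold second_image, real_quartic, critical_parameter; field. }
assert (Eb : critical_parameter (3 / 2) = - 8 / 27) by (unfold critical_parameter; field).
rewrite Et, Eb in *.
(* the loss [7/16 (z_n - z_0)] telescopes *)
apply Rle_trans with (32 / 9 - 14 / 10 - 7 / 16 * (Nat.iter n (real_quartic (- 8 / 27)) (- 9 / 32) + 9 / 32)).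
{ destruct (forward_orbit (- 8 / 27) (- 9 / 32) n Hb ltac:(lra)) as [O _]; lra. }
induction n as [| n IH].
- unfold forward_phase, log_coordinate; simpl Nat.iter; simpl INR.
  rewrite Rabs_left by lra; replace (- / (- 9 / 32)) with (32 / 9) by field.
  replace (- (- 9 / 32)) with (9 / 32) by field.
  assert (L : - (14 / 10) <= ln (9 / 32)); [| lra].
  replace (9 / 32) with (/ (32 / 9)) by field; rewrite ln_Rinv by lra.
  assert (L1 : ln (32 / 9) <= ln ((47 / 40) ^ 8)) by (apply ln_le; lra).
  rewrite ln_pow in L1 by lra; pose proof (ln_le_sub_1 (47 / 40) ltac:(lra)).
  simpl INR in L1; lra.
- rewrite forward_phase_step by (auto; lra).
  pose proof (forward_orbit_increasing (- 8 / 27) (- 9 / 32) 0 n Hb ltac:(lra)) as M.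
  simpl Nat.iter in M.
  destruct (forward_orbit (- 8 / 27) (- 9 / 32) n Hb ltac:(lra)) as [O _].
  rewrite Nat.iter_succ; set (z := Nat.iter n (real_quartic (- 8 / 27)) (- 9 / 32)) in *.
  destruct (forward_step _ z Hb O) as (F1 & F2 & F3 & F4).
  pose proof (abel_defect_lower (- 8 / 27) z ltac:(lra)) as L.
  assert (X : - (7 / 16) * (real_quartic (- 8 / 27) z - z) <= abel_defect (- 8 / 27) z); [| lra].
  eapply Rle_trans; [| apply L]; rewrite F3.
  assert (z2 : 0 <= z ^ 2 <= 81 / 1024) by (split; [apply pow2_ge_0 | nra]).
  set (U := 1 + - 8 / 27 * z ^ 2) in *.
  assert (HU : 97 / 100 <= U) by (unfold U; lra).
  assert (Hm : 23 / 32 <= 1 + z * U) by nra.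
  rewrite <- Rle_div_r by lra.
  assert (K : 8 / 27 <= 7 / 16 * (U * (1 + z * U))) by nra.
  nra.
Qed.

Lemma abel_defect_nonneg z : 0 < z <= 3 / 5 -> 0 <= abel_defect (- 8 / 27) z.
Proof.
intros Hz; unfold abel_defect.
assert (z2 : 0 <= z ^ 2 <= 9 / 25) by (split; [apply pow2_ge_0 | nra]).
assert (HU : 89 / 100 <= 1 + - 8 / 27 * z ^ 2 <= 1) by lra.
set (U := 1 + - 8 / 27 * z ^ 2) in *.
assert (Hm : 1 <= 1 + z * U) by nra.
pose proof (ln_lower _ Hm) as L.
assert (E : U / (1 + z * U) - 1 + 2 * (1 + z * U - 1) / (1 + z * U + 1) =
  z ^ 2 * (2 * (- 8 / 27) + - 8 / 27 * z * U + U ^ 2) / ((1 + z * U) * (2 + z * U))).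
{ replace (2 * (- 8 / 27) + - 8 / 27 * z * U + U ^ 2) with
    (- 8 / 27 * (2 + z * U) + U ^ 2) by ring.
  replace (z ^ 2 * (- 8 / 27 * (2 + z * U) + U ^ 2)) with
    ((U - 1) * (2 + z * U) + z ^ 2 * U ^ 2) by (unfold U; ring).
  field; lra. }
assert (P : 0 <= z ^ 2 * (2 * (- 8 / 27) + - 8 / 27 * z * U + U ^ 2)
                 / ((1 + z * U) * (2 + z * U))); [| lra].
apply Rmult_le_pos; [| left; apply Rinv_0_lt_compat, Rmult_lt_0_compat; lra].
apply Rmult_le_pos; [lra |].
clearbody U; assert (z * U <= z * 1) by (apply Rmult_le_compat_l; lra).
assert (89 / 100 * (89 / 100) <= U * U) by (apply Rmult_le_compat; lra).
simpl; lra.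
Qed.

Lemma backward_phase_at_left_end n :
  backward_phase (critical_parameter (3 / 2)) (3 / 2) (S n) <= 0.
Proof.
assert (Eb : critical_parameter (3 / 2) = - 8 / 27) by (unfold critical_parameter; field).
rewrite Eb.
assert (Hb : - 8 / 27 <= - 8 / 27 <= 0) by lra.
assert (Hy : 0 < 3 / 2 <= 33 / 20) by lra.
destruct (backward_orbit_range _ _ 0 Hb Hy) as (_ & Y1 & E1).
destruct (backward_orbit_range _ _ 1 Hb Hy) as (_ & Y2 & E2).
change (backward_orbit (- 8 / 27) (3 / 2) 0) with (3 / 2) in E1.
assert (L1 : backward_orbit (- 8 / 27) (3 / 2) 1 <= 92 / 100).
{ apply (real_quartic_reflects_le (- 8 / 27)); try lra.
  rewrite E1; unfold real_quartic; lra. }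
assert (L2 : backward_orbit (- 8 / 27) (3 / 2) 2 <= 3 / 5).
{ apply (real_quartic_reflects_le (- 8 / 27)); try lra.
  rewrite E2; unfold real_quartic; lra. }
assert (Small : forall k, 0 < backward_orbit (- 8 / 27) (3 / 2) (S (S k)) <= 3 / 5).
{ induction k as [| k IH]; [lra |].
  destruct (backward_orbit_range _ _ (S (S k)) Hb Hy) as (_ & Y & E).
  destruct (backward_step _ _ Hb Y) as (_ & _ & _ & S); rewrite E in S; lra. }
induction n as [| n IH].
- unfold backward_phase, log_coordinate.
  set (y := backward_orbit (- 8 / 27) (3 / 2) 1) in *.
  rewrite Rabs_pos_eq by lra.
  pose proof (ln_le_sub_1 y ltac:(lra)).
  assert (1 <= / y) by (rewrite <- Rinv_1; apply Rinv_le_contravar; lra).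
  simpl INR; lra.
- destruct (backward_phase_step _ _ (S n) Hb Hy) as (E & _ & _).
  pose proof (abel_defect_nonneg _ (Small n)); lra.
Qed.

Lemma forward_phase_at_right_end n :
  forward_phase (critical_parameter (33 / 20)) (second_image (33 / 20)) (2 + n) <= 84 / 100.
Proof.
pose proof (critical_parameter_range (33 / 20) ltac:(lra)) as Hb.
pose proof (second_image_range (33 / 20) ltac:(lra)) as Ht.
assert (Eb : critical_parameter (33 / 20) = - 8600 / 35937) by (unfold critical_parameter; field).
assert (Et : - 15626 / 10000 <= second_image (33 / 20) <= - 15625 / 10000).
{ unfold second_image; rewrite critical_value by lra; rewrite Eb; unfold real_quartic; lra. }
rewrite Eb in *; set (b := - 8600 / 35937) in *; set (t := second_image (33 / 20)) in *.
assert (Hb2 : - 23931 / 100000 <= b <= - 2393 / 10000) by (unfold b; lra).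
clearbody b t.
assert (E1 : - 55 / 100 <= real_quartic b t <= - 545 / 1000).
{ assert (t2 : 24414 / 10000 <= t ^ 2 <= 24418 / 10000) by nra.
  assert (t4 : 596 / 100 <= t ^ 4 <= 5963 / 1000) by nra.
  unfold real_quartic; nra. }
set (z1 := real_quartic b t) in *.
assert (E2 : - 27 / 100 <= real_quartic b z1 <= - 268 / 1000).
{ clearbody z1; assert (t2 : 297 / 1000 <= z1 ^ 2 <= 3025 / 10000) by nra.
  assert (t4 : 882 / 10000 <= z1 ^ 4 <= 9151 / 100000) by nra.
  assert (- 248 / 1000 <= z1 + z1 ^ 2 <= - 2475 / 10000) by nra.
  unfold real_quartic; nra. }
assert (B2 : forward_phase b t 2 <= 4685 / 10000).
{ unfold forward_phase, log_coordinate; simpl Nat.iter; fold z1.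
  set (z2 := real_quartic b z1) in *; clearbody z2.
  rewrite Rabs_left by lra; simpl INR.
  assert (- / z2 <= 37314 / 10000).
  { replace (37314 / 10000) with (/ (10000 / 37314)) by field; rewrite <- Rinv_opp.
    apply Rinv_le_contravar; lra. }
  assert (L1 : ln (- z2) <= ln ((/ (25 / 13)) ^ 2)) by (apply ln_le; lra).
  rewrite ln_pow, ln_Rinv in L1 by lra.
  pose proof (ln_lower (25 / 13) ltac:(lra)) as L2; simpl INR in L1; lra. }
assert (Z2 : Nat.iter 2 (real_quartic b) t = real_quartic b z1) by reflexivity.
(* the gain [100/73 (z_n - z_2)] telescopes *)
apply Rle_trans with (4685 / 10000 +
  100 / 73 * (Nat.iter (2 + n) (real_quartic b) t - real_quartic b z1)).
2:{ destruct (forward_orbit b t (2 + n) Hb ltac:(lra)) as [O _]; lra. }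
induction n as [| n IH].
- rewrite Nat.add_0_r, Z2; lra.
- rewrite Nat.add_succ_r, forward_phase_step by (auto; lra); rewrite Nat.iter_succ.
  pose proof (forward_orbit_increasing b t 2 n Hb ltac:(lra)) as M; rewrite Z2 in M.
  destruct (forward_orbit b t (2 + n) Hb ltac:(lra)) as [O _].
  set (z := Nat.iter (2 + n) (real_quartic b) t) in *.
  destruct (forward_step b z Hb O) as (F1 & F2 & F3 & F4).
  pose proof (abel_defect_upper b z ltac:(lra)) as L.
  assert (X : abel_defect b z <= 100 / 73 * (real_quartic b z - z)); [| lra].
  eapply Rle_trans; [apply L |]; rewrite F3.
  pose proof (pow2_ge_0 z) as z2; set (U := 1 + b * z ^ 2) in *.
  rewrite Rle_div_l by lra.
  assert (Hm : 73 / 100 <= 1 + z * U) by nra.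
  assert (K : b + U ^ 2 <= 100 / 73 * (U * (1 + z * U))) by nra.
  nra.
Qed.

Lemma backward_phase_at_right_end n :
  - 108 / 100 <= backward_phase (critical_parameter (33 / 20)) (33 / 20) (2 + n).
Proof.
assert (Eb : critical_parameter (33 / 20) = - 8600 / 35937) by (unfold critical_parameter; field).
rewrite Eb; set (b := - 8600 / 35937) in *.
assert (Hb2 : - 23931 / 100000 <= b <= - 2393 / 10000) by (unfold b; lra).
assert (Hb : - 8 / 27 <= b <= 0) by lra.
assert (Hy : 0 < 33 / 20 <= 33 / 20) by lra.
clearbody b.
destruct (backward_orbit_range _ _ 0 Hb Hy) as (_ & Y1 & E1).
destruct (backward_orbit_range _ _ 1 Hb Hy) as (_ & Y2 & E2).
change (backward_orbit b (33 / 20) 0) with (33 / 20) in E1.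
assert (L1 : 889 / 1000 <= backward_orbit b (33 / 20) 1 <= 969 / 1000).
{ split; apply (real_quartic_reflects_le b); try lra;
  rewrite E1; unfold real_quartic; lra. }
assert (L2 : 579 / 1000 <= backward_orbit b (33 / 20) 2 <= 62 / 100).
{ split; apply (real_quartic_reflects_le b); try lra;
  rewrite E2; unfold real_quartic; lra. }
assert (B2 : - 455 / 1000 <= backward_phase b (33 / 20) 2).
{ unfold backward_phase, log_coordinate; set (y := backward_orbit b (33 / 20) 2) in *.
  rewrite Rabs_pos_eq by lra; pose proof (ln_ge_1_sub_inv y ltac:(lra)).
  assert (/ y <= / (579 / 1000)) by (apply Rinv_le_contravar; lra).
  assert (E : / (579 / 1000) = 1000 / 579) by field; rewrite E in *; simpl INR; lra. }
apply Rle_trans with (- 108 / 100 + backward_orbit b (33 / 20) (2 + n)).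
{ destruct (backward_orbit_range _ _ (2 + n) Hb Hy) as [O _]; lra. }
induction n as [| n IH]; [rewrite Nat.add_0_r; lra |].
rewrite Nat.add_succ_r.
destruct (backward_phase_step _ _ (2 + n) Hb Hy) as (E & _ & U); lra.
Qed.

(** * The intermediate value argument *)

Lemma continuity_dominated (f g h : R -> R) : continuity f -> continuity g ->
  (forall x y, Rabs (h x - h y) <= Rabs (f x - f y) + Rabs (g x - g y)) -> continuity h.
Proof.
intros Hf Hg H x; apply continuity_pt_locally; intros eps.
pose proof (proj1 (continuity_pt_locally f x) (Hf x) (pos_div_2 eps)) as F.
pose proof (proj1 (continuity_pt_locally g x) (Hg x) (pos_div_2 eps)) as G.
apply (filter_imp (fun u => Rabs (f u - f x) < pos_div_2 eps /\
                            Rabs (g u - g x) < pos_div_2 eps)); [| now apply filter_and].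
intros u [A B]; simpl in A, B; specialize (H u x); lra.
Qed.

(** Clamping the critical point extends the family continuously to parameters in all
    of [R], so that the intermediate value theorem applies to everywhere continuous
    functions. *)
Definition clamp (s : R) : R := Rmax (3 / 2) (Rmin s (33 / 20)).

Lemma clamp_range s : 3 / 2 <= clamp s <= 33 / 20.
Proof.
unfold clamp; split; [apply Rmax_l |]; apply Rmax_lub; [lra | apply Rmin_r].
Qed.

Lemma clamp_id s : 3 / 2 <= s <= 33 / 20 -> clamp s = s.
Proof. intros H; unfold clamp; rewrite Rmin_left, Rmax_right; lra. Qed.

Lemma clamp_continuous : continuity clamp.
Proof.
apply (continuity_dominated id (fun _ => 0)); [apply derivable_continuous, derivable_id | apply continuity_const; congruence |].
intros x y; unfold clamp, id, Rmax, Rmin.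
repeat destruct Rle_dec; unfold Rabs; repeat destruct Rcase_abs; lra.
Qed.

Lemma continuity_comp_pointwise (f g : R -> R) : continuity g ->
  (forall s, continuity_pt f (g s)) -> continuity (fun s => f (g s)).
Proof. intros Hg Hf s; apply (continuity_pt_comp g f); auto. Qed.

Lemma critical_parameter_continuous : continuity (fun s => critical_parameter (clamp s)).
Proof.
apply (continuity_comp_pointwise critical_parameter); [apply clamp_continuous |].
intros s; pose proof (clamp_range s); apply derivable_continuous_pt, ex_derive_Reals_0.
unfold critical_parameter; auto_derive.
assert (0 < clamp s ^ 3) by (apply pow_lt; lra); simpl in *; lra.
Qed.

Lemma real_quartic_continuous2 (b z : R -> R) : continuity b -> continuity z ->
  continuity (fun s => real_quartic (b s) (z s)).
Proof.
intros Hb Hz.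
assert (P : forall n, continuity (fun s => z s ^ n)).
{ intros n; apply (continuity_comp_pointwise (fun x => x ^ n)); auto.
  intros s; apply derivable_continuous_pt, derivable_pt_pow. }
apply (continuity_plus (fun s => z s + z s ^ 2) (fun s => b s * z s ^ 4)).
- now apply (continuity_plus z (fun s => z s ^ 2)).
- now apply (continuity_mult b (fun s => z s ^ 4)).
Qed.

Lemma log_coordinate_continuous z : z <> 0 -> continuity_pt log_coordinate z.
Proof.
intros Hz; unfold log_coordinate.
apply (continuity_pt_plus (fun z => - / z) (fun z => ln (Rabs z))).
- apply derivable_continuous_pt, ex_derive_Reals_0; auto_derive; auto.
- apply (continuity_pt_comp Rabs ln); [apply Rcontinuity_abs |].
  apply derivable_continuous_pt; exists (/ Rabs z); apply derivable_pt_lim_ln; now apply Rabs_pos_lt.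
Qed.

Definition family_forward (n : nat) (s : R) : R :=
  forward_phase (critical_parameter (clamp s)) (second_image (clamp s)) n.

Definition family_backward (n : nat) (s : R) : R :=
  backward_phase (critical_parameter (clamp s)) (clamp s) n.

Lemma clamp_param s : param_range (critical_parameter (clamp s)).
Proof. apply critical_parameter_range, clamp_range. Qed.

Lemma clamp_param_weak s : - 8 / 27 <= critical_parameter (clamp s) <= 0.
Proof. destruct (clamp_param s); lra. Qed.

Lemma clamp_second_image s : - 8 / 5 <= second_image (clamp s) < 0.
Proof. pose proof (second_image_range _ (clamp_range s)); lra. Qed.

Lemma family_forward_continuous n : continuity (family_forward n).
Proof.
assert (O : forall k, continuity (fun s =>
  Nat.iter k (real_quartic (critical_parameter (clamp s))) (second_image (clamp s)))).
{ induction k as [| k IH]; simpl.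
  - unfold second_image; apply real_quartic_continuous2; [apply critical_parameter_continuous |].
    apply real_quartic_continuous2; [apply critical_parameter_continuous | apply clamp_continuous].
  - apply real_quartic_continuous2; auto; apply critical_parameter_continuous. }
unfold family_forward, forward_phase.
apply (continuity_minus (fun s => log_coordinate
  (Nat.iter n (real_quartic (critical_parameter (clamp s))) (second_image (clamp s))))
  (fun _ => INR n)); [| apply continuity_const; congruence].
apply (continuity_comp_pointwise log_coordinate); auto.
intros s; apply log_coordinate_continuous.
destruct (forward_orbit _ _ n (clamp_param s) (clamp_second_image s)); lra.
Qed.

Lemma family_backward_continuous n : continuity (family_backward n).
Proof.
assert (Y : forall s, 0 < clamp s <= 33 / 20) by (intro s; pose proof (clamp_range s); lra).
assert (O : forall k, continuity (fun s =>
  backward_orbit (critical_parameter (clamp s)) (clamp s) k)).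
{ induction k as [| k IH]; simpl; [apply clamp_continuous |].
  apply (continuity_dominated _ _ _ IH critical_parameter_continuous); intros x y.
  destruct (backward_orbit_range _ _ k (clamp_param_weak x) (Y x)) as (_ & Px & Ex).
  destruct (backward_orbit_range _ _ k (clamp_param_weak y) (Y y)) as (_ & Py & Ey).
  rewrite <- Ex at 2; rewrite <- Ey at 2.
  apply real_quartic_expands; [apply clamp_param_weak | |]; simpl in *; lra. }
unfold family_backward, backward_phase.
apply (continuity_plus (fun s => log_coordinate
  (backward_orbit (critical_parameter (clamp s)) (clamp s) n))
  (fun _ => INR n)); [| apply continuity_const; congruence].
apply (continuity_comp_pointwise log_coordinate); auto.
intros s; apply log_coordinate_continuous.
destruct (backward_orbit_range _ _ n (clamp_param_weak s) (Y s)); lra.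
Qed.

Lemma uniform_limit (f : nat -> R -> R) (e : nat -> R) :
  (forall n, continuity (f n)) -> is_lim_seq e 0 ->
  (forall n m s, (n <= m)%nat -> Rabs (f m s - f n s) <= e n) ->
  exists F, continuity F /\ forall s, is_lim_seq (fun n => f n s) (F s).
Proof.
intros Hc He H.
assert (E : forall eps, 0 < eps -> exists N, e N < eps).
{ intros eps Heps; apply is_lim_seq_spec in He.
  destruct (He (mkposreal eps Heps)) as [N HN]; exists N.
  specialize (HN N (le_n N)); simpl in HN; rewrite Rminus_0_r in HN.
  pose proof (Rle_abs (e N)); lra. }
assert (L : forall s, is_lim_seq (fun n => f n s) (real (Lim_seq (fun n => f n s)))).
{ intros s; apply Lim_seq_correct', ex_lim_seq_cauchy_corr; intros eps.
  destruct (E (eps / 2)) as [N HN]; [destruct eps; simpl; lra |].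
  exists N; intros n m Hn Hm.
  pose proof (H N n s Hn); pose proof (H N m s Hm).
  replace (f n s - f m s) with ((f n s - f N s) - (f m s - f N s)) by ring.
  eapply Rle_lt_trans; [apply Rabs_triang |]; rewrite Rabs_Ropp; lra. }
exists (fun s => real (Lim_seq (fun n => f n s))); split; auto.
assert (C : forall n s, Rabs (real (Lim_seq (fun n => f n s)) - f n s) <= e n).
{ intros n s; specialize (L s); set (l := real _) in *.
  assert (L2 : is_lim_seq (fun m => Rabs (f (m + n)%nat s - f n s)) (Rabs (l - f n s))).
  { apply (is_lim_seq_abs _ (Finite (l - f n s))).
    apply is_lim_seq_minus'; [| apply is_lim_seq_const].
    now apply (is_lim_seq_incr_n (fun m => f m s)). }
  exact (is_lim_seq_le _ (fun _ => e n) (Finite _) (Finite _)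
    (fun m => H n (m + n)%nat s ltac:(lia)) L2 (is_lim_seq_const (e n))). }
intros x; apply continuity_pt_locally; intros eps.
destruct (E (eps / 3)) as [N HN]; [destruct eps; simpl; lra |].
assert (e3 : 0 < eps / 3) by (destruct eps; simpl; lra).
pose proof (proj1 (continuity_pt_locally (f N) x) (Hc N x) (mkposreal _ e3)) as K.
revert K; apply filter_imp; intros u Hu; simpl in Hu.
pose proof (C N u) as Cu; pose proof (C N x) as Cx.
apply Rabs_le_between in Cu; apply Rabs_le_between in Cx; apply Rabs_lt_between in Hu.
apply Rabs_lt_between; lra.
Qed.

Lemma inverse_affine_lim (a k r : R) : 0 < k -> is_lim_seq (fun n => a * / (r + k * INR n)) 0.
Proof.
intros Hk.
replace (Finite 0) with (Rbar_mult a 0) by (simpl; f_equal; ring).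
apply is_lim_seq_scal_l.
replace (Finite 0) with (Rbar_inv p_infty) by reflexivity.
apply is_lim_seq_inv; [| discriminate].
apply is_lim_seq_spec; intros M.
destruct (INR_unbounded ((M - r) / k)) as [N HN]; exists N; intros n Hn.
apply le_INR in Hn.
assert ((M - r) / k < INR n) by lra.
assert ((M - r) < k * INR n); [| lra].
apply (Rmult_lt_compat_l k) in H; [| lra].
replace (k * ((M - r) / k)) with (M - r) in H by (field; lra); lra.
Qed.

(** The forward phase is counted from the second image of [c], whence the shift by [2].
    The difference of the two limits is continuous in [c] and changes sign: at [c = 3 / 2]
    the forward orbit is ahead, while at [c = 33 / 20] the second image has moved so far
    to the left that its orbit is late. *)
Lemma matching_parameter : exists c x : R, 3 / 2 < c <= 33 / 20 /\
  is_lim_seq (forward_phase (critical_parameter c) (second_image c)) (x + 2) /\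
  is_lim_seq (backward_phase (critical_parameter c) c) x.
Proof.
assert (Y : forall s, 0 < clamp s <= 33 / 20) by (intro s; pose proof (clamp_range s); lra).
destruct (uniform_limit family_forward (fun n => 25 * / (5 / 8 + 6 / 25 * INR n)))
  as (P & CP & LP).
- apply family_forward_continuous.
- apply inverse_affine_lim; lra.
- intros n m s Hnm; eapply Rle_trans.
  + apply (forward_phase_close _ _ n m (clamp_param s) (clamp_second_image s) Hnm).
  + apply Rmult_le_compat_l; [lra |].
    apply (forward_orbit_small _ _ n (clamp_param s) (clamp_second_image s)).
- destruct (uniform_limit family_backward (fun n => 2 * / (20 / 33 + 7 / 20 * INR n)))
    as (Q & CQ & LQ).
  + apply family_backward_continuous.
  + apply inverse_affine_lim; lra.
  + intros n m s Hnm; eapply Rle_trans.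
    * apply (backward_phase_close _ _ n m (clamp_param_weak s) (Y s) Hnm).
    * apply Rmult_le_compat_l; [lra |].
      pose proof (backward_orbit_small _ _ n (clamp_param_weak s) (Y s)) as S.
      destruct (backward_orbit_range _ _ n (clamp_param_weak s) (Y s)) as [R1 _].
      pose proof (Y s); pose proof (pos_INR n).
      assert (/ (33 / 20) <= / clamp s) by (apply Rinv_le_contravar; lra).
      assert (E : / (33 / 20) = 20 / 33) by field.
      rewrite <- (Rinv_inv (backward_orbit _ _ _)); apply Rinv_le_contravar; lra.
  + assert (Left : P (3 / 2) - 2 - Q (3 / 2) > 0).
    { assert (A : 2 + 3 / 100 <= P (3 / 2)).
      { apply (is_lim_seq_le (fun _ => 2 + 3 / 100) (fun n => family_forward n (3 / 2))
          (Finite _) (Finite _)); [| apply is_lim_seq_const | apply LP].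
        intros n; unfold family_forward; rewrite clamp_id by lra.
        apply forward_phase_at_left_end. }
      assert (B : Q (3 / 2) <= 0).
      { apply (is_lim_seq_le (fun n => family_backward (S n) (3 / 2)) (fun _ => 0)
          (Finite _) (Finite _)); [| apply (is_lim_seq_incr_1 (fun n => family_backward n (3 / 2))), LQ
           | apply is_lim_seq_const].
        intros n; unfold family_backward; rewrite clamp_id by lra.
        apply backward_phase_at_left_end. }
      lra. }
    assert (Right : P (33 / 20) - 2 - Q (33 / 20) < 0).
    { assert (A : P (33 / 20) <= 84 / 100).
      { apply (is_lim_seq_le (fun n => family_forward (n + 2) (33 / 20)) (fun _ => 84 / 100)
          (Finite _) (Finite _));
          [| apply (is_lim_seq_incr_n (fun n => family_forward n (33 / 20)) 2), LP
           | apply is_lim_seq_const].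
        intros n; unfold family_forward; rewrite clamp_id, Nat.add_comm by lra.
        apply forward_phase_at_right_end. }
      assert (B : - 108 / 100 <= Q (33 / 20)).
      { apply (is_lim_seq_le (fun _ => - 108 / 100) (fun n => family_backward (n + 2) (33 / 20))
          (Finite _) (Finite _));
          [| apply is_lim_seq_const
           | apply (is_lim_seq_incr_n (fun n => family_backward n (33 / 20)) 2), LQ].
        intros n; unfold family_backward; rewrite clamp_id, Nat.add_comm by lra.
        apply backward_phase_at_right_end. }
      lra. }
    destruct (IVT_gen (fun s => P s - 2 - Q s) (3 / 2) (33 / 20) 0) as (s & Hs & E).
    * apply (continuity_minus (fun s => P s - 2) Q); auto.
      apply (continuity_minus P (fun _ => 2)); auto; apply continuity_const; congruence.
    * rewrite Rmin_right, Rmax_left by lra; lra.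
    * rewrite Rmin_left, Rmax_right in Hs by lra.
      assert (Hs2 : 3 / 2 < s).
      { destruct (Rle_lt_or_eq_dec (3 / 2) s (proj1 Hs)) as [L | L]; auto; subst s; lra. }
      exists s, (Q s); split; [lra |].
      specialize (LP s); specialize (LQ s); unfold family_forward, family_backward in LP, LQ.
      rewrite clamp_id in LP, LQ by lra; split; auto.
      replace (Q s + 2) with (P s) by lra; auto.
Qed.

(** * The fixed critical point *)

Lemma RtoC_opp_inv (x : R) : x <> 0 -> (- / RtoC x)%C = RtoC (- / x).
Proof. intros Hx; rewrite RtoC_opp, RtoC_inv; auto. Qed.

Lemma cconv_RtoC (u : nat -> R) (l : R) : is_lim_seq u l ->
  cconv (fun n => RtoC (u n)) (RtoC l).
Proof.
intros H eps He; apply is_lim_seq_spec in H.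
destruct (H (mkposreal eps He)) as [N HN]; exists N; intros n Hn.
rewrite <- RtoC_minus, Cmod_R; exact (HN n Hn).
Qed.

Lemma critical_orbit c n :
  Nat.iter (n + 2) (quartic (critical_parameter c)) (RtoC c) =
  RtoC (Nat.iter n (real_quartic (critical_parameter c)) (second_image c)).
Proof. rewrite iter_quartic_RtoC, Nat.iter_add; reflexivity. Qed.

Lemma critical_orbit_negative c n : 3 / 2 <= c <= 33 / 20 ->
  - / (5 / 8 + 6 / 25 * INR n) <=
    Nat.iter n (real_quartic (critical_parameter c)) (second_image c) < 0.
Proof.
intros Hc; pose proof (critical_parameter_range c Hc) as Hb.
pose proof (second_image_range c Hc) as Ht.
destruct (forward_orbit _ (second_image c) n Hb ltac:(lra)) as [O _].
pose proof (forward_orbit_small _ (second_image c) n Hb ltac:(lra)); lra.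
Qed.

Lemma critical_point_in_basin c : 3 / 2 <= c <= 33 / 20 ->
  parabolic_basin (quartic (critical_parameter c)) (RtoC c).
Proof.
intros Hc; split.
- intros P [eps HP].
  pose proof (inverse_affine_lim 1 (6 / 25) (5 / 8) ltac:(lra)) as L.
  apply is_lim_seq_spec in L; destruct (L eps) as [N HN].
  exists (N + 2)%nat; intros n Hn.
  replace n with ((n - 2) + 2)%nat by lia; rewrite critical_orbit.
  apply HP, C_NormedModule_mixin_compat1.
  set (z := Nat.iter (n - 2) _ _).
  change (Cmod (RtoC z - RtoC 0)%C < eps); rewrite <- RtoC_minus, Cmod_R, Rminus_0_r.
  pose proof (critical_orbit_negative c (n - 2) Hc) as B; fold z in B.
  specialize (HN (n - 2)%nat ltac:(lia)); rewrite Rminus_0_r in HN.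
  apply Rabs_lt_between in HN; apply Rabs_lt_between; lra.
- intros [| [| n]] E.
  + apply RtoC_inj in E; lra.
  + simpl in E; rewrite quartic_RtoC, critical_value in E by lra.
    apply RtoC_inj in E; nra.
  + replace (S (S n)) with (n + 2)%nat in E by lia; rewrite critical_orbit in E.
    apply RtoC_inj in E; pose proof (critical_orbit_negative c n Hc); lra.
Qed.

Lemma fatou_coordinate_critical (c x : R) : 3 / 2 <= c <= 33 / 20 ->
  is_lim_seq (forward_phase (critical_parameter c) (second_image c)) (x + 2) ->
  fatou_coordinate (critical_parameter c) (RtoC c) = RtoC x.
Proof.
intros Hc L; apply Clim_eq, (cconv_shift _ _ 2).
replace (RtoC x) with (RtoC (x + 2) + - (2))%C by (rewrite RtoC_plus; ring).
refine (cconv_ext _ _ _ _ (cconv_add_const _ _ (- (2))%C (cconv_RtoC _ _ L))).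
exists 0%nat; intros n _; rewrite critical_orbit.
pose proof (critical_orbit_negative c n Hc) as O.
unfold forward_phase, log_coordinate.
set (z := Nat.iter n (real_quartic (critical_parameter c)) (second_image c)) in *.
assert (P : 0 < - z) by lra.
rewrite RtoC_opp_inv, Clog_RtoC by (try rewrite <- Rinv_opp; try apply Rinv_0_lt_compat; lra).
rewrite Rabs_left, <- Rinv_opp, ln_Rinv, plus_INR by lra; simpl (INR 2).
rewrite <- RtoC_opp, <- !RtoC_plus, <- !RtoC_minus; f_equal; ring.
Qed.

(** The ratio of [n - x] to [v n] tends to [1], so that their logarithms may be
    exchanged: this inverts [w - log w] asymptotically. *)
Lemma phase_inversion (v : nat -> R) (x : R) :
  is_lim_seq v p_infty -> (forall n, 0 < v n) ->
  is_lim_seq (fun n => INR n - v n - ln (v n)) x ->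
  is_lim_seq (fun n => INR n - v n - x - ln (INR n - x)) 0.
Proof.
intros Hv Pv Hx.
assert (L1 : is_lim_seq (fun n => ln (v n) / v n) 0).
{ refine (filterlim_comp _ _ _ v (fun y => ln y / y) _ _ _ Hv _).
  exact is_lim_div_ln_p. }
assert (L2 : is_lim_seq (fun n => / v n) 0).
{ replace (Finite 0) with (Rbar_inv p_infty) by reflexivity.
  apply is_lim_seq_inv; auto; discriminate. }
set (d := fun n => INR n - v n - ln (v n)) in *.
assert (L3 : is_lim_seq (fun n => 1 + ln (v n) / v n + (d n - x) * / v n) 1).
{ replace (Finite 1) with (Finite (1 + 0 + (x - x) * 0)) by (f_equal; ring).
  apply is_lim_seq_plus'; [apply is_lim_seq_plus'; auto; apply is_lim_seq_const |].
  apply is_lim_seq_mult'; auto; apply is_lim_seq_minus'; auto; apply is_lim_seq_const. }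
assert (L4 : is_lim_seq (fun n => ln (1 + ln (v n) / v n + (d n - x) * / v n)) 0).
{ rewrite <- ln_1.
  apply (is_lim_seq_continuous ln _ 1); auto.
  apply derivable_continuous_pt; exists (/ 1); apply derivable_pt_lim_ln; lra. }
assert (L5 : is_lim_seq (fun n => d n - x - ln (1 + ln (v n) / v n + (d n - x) * / v n)) 0).
{ replace (Finite 0) with (Finite (x - x - 0)) by (f_equal; ring).
  apply is_lim_seq_minus'; auto; apply is_lim_seq_minus'; auto; apply is_lim_seq_const. }
refine (is_lim_seq_ext_loc _ _ _ _ L5).
apply is_lim_seq_spec in L3; destruct (L3 (mkposreal _ Rlt_0_1)) as [N HN].
exists N; intros n Hn; specialize (HN n Hn); simpl in HN; specialize (Pv n).
apply Rabs_lt_between in HN.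
set (r := 1 + ln (v n) / v n + (d n - x) * / v n) in *.
replace (INR n - x) with (v n * r) by (unfold r, d; field; lra).
rewrite ln_mult by lra; unfold d; ring.
Qed.

Lemma fatou_parameterization_critical (c x : R) : 3 / 2 <= c <= 33 / 20 ->
  is_lim_seq (backward_phase (critical_parameter c) c) x ->
  fatou_parameterization (critical_parameter c) (RtoC x) = RtoC c.
Proof.
intros Hc L; pose proof (critical_parameter_range c Hc) as [b1 b2].
set (b := critical_parameter c) in *.
assert (Hb : - 8 / 27 <= b <= 0) by lra.
assert (Hy : 0 < c <= 33 / 20) by lra.
set (y := backward_orbit b c).
assert (Py : forall n, 0 < y n) by (intro n; apply (backward_orbit_range b c n Hb Hy)).
assert (Small : forall n, 7 / 20 * INR n <= / y n).
{ intro n; pose proof (backward_orbit_small b c n Hb Hy).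
  assert (0 < / c) by (apply Rinv_0_lt_compat; lra); unfold y; lra. }
(* from index [6] on, [y n <= 1/2] and [1 / y] grows by at least [1/2] at each step *)
assert (Fast : forall k, 2 + INR k / 2 <= / y (6 + k)%nat).
{ induction k as [| k IH].
  - pose proof (Small 6%nat); simpl INR in *; rewrite Nat.add_0_r; lra.
  - rewrite Nat.add_succ_r, S_INR; set (n := (6 + k)%nat) in *.
    destruct (backward_orbit_range b c n Hb Hy) as (_ & R2 & E); fold y in R2, E.
    destruct (backward_step b _ Hb R2) as (_ & _ & _ & Dec).
    pose proof (pos_INR k); rewrite E in Dec.
    assert (H2 : y n <= 1 / 2).
    { rewrite <- (Rinv_inv (y n)); replace (1 / 2) with (/ 2) by field.
      apply Rinv_le_contravar; lra. }
    set (z := y (S n)) in *.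
    assert (X : / z - / y n = (1 + b * z ^ 2) / (1 + z * (1 + b * z ^ 2))).
    { assert (z2 : 0 <= z ^ 2 <= 1 / 4) by nra.
      assert (0 <= z * (1 + b * z ^ 2)) by (apply Rmult_le_pos; nra).
      rewrite <- E, real_quartic_factor; field; lra. }
    assert (X2 : 1 / 2 <= (1 + b * z ^ 2) / (1 + z * (1 + b * z ^ 2))); [| lra].
    assert (z2 : 0 <= z ^ 2 <= 1 / 4) by nra.
    assert (U : 9 / 10 <= 1 + b * z ^ 2 <= 1) by nra.
    apply (Rle_div_r (1 / 2)); nra. }
rewrite (fatou_parameterization_value b x (fun n => RtoC (- / y n)) 6).
- change (y 0%nat) with c; rewrite RtoC_opp_inv by (apply Rlt_not_eq, Ropp_lt_gt_0_contravar, Rinv_0_lt_compat; lra).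
  f_equal; field; lra.
- lra.
- intros n; destruct (backward_orbit_range b c n Hb Hy) as (_ & R2 & E); fold y in R2, E.
  unfold at_infinity; rewrite <- (RtoC_opp_inv (y (S n))) by lra.
  rewrite Copp_inv, Cinv_involutive.
  replace (- - RtoC (y (S n)))%C with (RtoC (y (S n))) by ring.
  rewrite quartic_RtoC, E, RtoC_opp_inv; auto; apply Rgt_not_eq, Py.
- intros n; rewrite Cmod_R, Rabs_Ropp.
  pose proof (Rinv_0_lt_compat _ (Py n)) as I; rewrite Rabs_pos_eq by lra.
  destruct (Nat.le_gt_cases 6 n) as [H6 | H6].
  + pose proof (Fast (n - 6)%nat) as F; replace (6 + (n - 6))%nat with n in F by lia.
    rewrite minus_INR in F by auto; simpl (INR 6) in F; lra.
  + apply lt_INR in H6; simpl (INR 6) in H6; lra.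
- assert (V : is_lim_seq (fun n => / y n) p_infty).
  { apply (is_lim_seq_le_p_loc (fun n => 7 / 20 * INR n)); [exists 0%nat; auto |].
    replace p_infty with (Rbar_mult (7 / 20) p_infty).
    - apply is_lim_seq_scal_l, is_lim_seq_INR.
    - apply is_Rbar_mult_unique, is_Rbar_mult_sym, is_Rbar_mult_p_infty_pos; simpl; lra. }
  assert (PV : forall n, 0 < / y n) by (intro n; apply Rinv_0_lt_compat, Py).
  assert (D : is_lim_seq (fun n => INR n - / y n - ln (/ y n)) x).
  { refine (is_lim_seq_ext _ _ _ _ L); intro n; unfold backward_phase, log_coordinate.
    fold y; rewrite ln_Rinv, Rabs_pos_eq by (auto; left; auto); ring. }
  pose proof (phase_inversion _ _ V PV D) as P.
  refine (cconv_ext _ _ _ _ (cconv_RtoC _ _ P)).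
  destruct (INR_unbounded (x + 1)) as [N HN]; exists N; intros n Hn.
  apply le_INR in Hn; unfold model.
  replace (- (RtoC x - INR n))%C with (RtoC (INR n - x)) by (rewrite RtoC_minus; ring).
  rewrite Clog_RtoC by lra.
  rewrite <- RtoC_minus, <- RtoC_plus, <- RtoC_minus; f_equal; ring.
Qed.

(** A point [z] with [Re (- 1 / z) <= 0] needs at least one iteration to enter the petal,
    so near [z] the coordinate factors through [f] and inherits its critical points. *)
Lemma fatou_coordinate_critical_point b (z : C) : - (1) <= b <= 1 ->
  parabolic_basin (quartic b) z -> Re (- / z)%C <= 0 ->
  (1 + 2 * z + 4 * b * z ^ 3)%C = 0%C -> cderiv (fatou_coordinate b) z 0.
Proof.
intros Hb Hz Hre Hcrit.
destruct (basin_enters_petal b z 102 Hb Hz) as [N HN].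
destruct N as [| N]; [simpl in HN; simpl in Hre; lra |].
destruct (cderiv_iter_quartic b N (quartic b z)) as [l1 D1].
pose proof (cderiv_comp (Nat.iter N (quartic b)) (quartic b) z _ _ (cderiv_quartic b z) D1) as D2.
rewrite Hcrit in D2.
assert (D3 : cderiv (Nat.iter (S N) (quartic b)) z (l1 * 0)%C).
{ refine (cderiv_ext_loc _ _ _ _ 1 Rlt_0_1 _ D2); intros h _; symmetry; apply Nat.iter_succ_r. }
destruct (fatou_coordinate_derivable_at b z (S N) _ Hb Hz HN D3) as [k Hk].
now replace (k * (l1 * 0))%C with (RtoC 0) in Hk by ring.
Qed.

Theorem proposition3 :
  exists b : R, (-8 / 27 < b < 0)%R /\
  exists L : C -> C, lavaurs_map (quartic b) L /\
  exists c : R,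
    parabolic_basin (quartic b) (RtoC c) /\
    L (RtoC c) = RtoC c /\
    is_derive (K := C_AbsRing) (V := C_NormedModule) L (RtoC c) (RtoC 0).
Proof.
destruct matching_parameter as (c & x & Hc & LF & LB).
assert (Hc' : 3 / 2 <= c <= 33 / 20) by lra.
pose proof (critical_parameter_gt c Hc) as b1.
destruct (critical_parameter_range c Hc') as [_ b2].
pose proof (critical_point_in_basin c Hc') as Bas.
pose proof (fatou_coordinate_critical c x Hc' LF) as EF.
pose proof (fatou_parameterization_critical c x Hc' LB) as EP.
pose proof (critical_parameter_eq c ltac:(lra)) as Crit.
set (b := critical_parameter c) in *.
assert (Hb : - (1) <= b <= 1) by lra.
exists b; split; [lra |].
exists (fun z => fatou_parameterization b (fatou_coordinate b z)); split.
- exists 0%C, (fatou_coordinate b), (fatou_parameterization b); repeat apply conj.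
  + exists (Rabs b), 1; split; [lra |]; intros z _; unfold quartic.
    replace (z + z ^ 2 + b * z ^ 4 - (z + z ^ 2 + 0 * z ^ 3))%C with (b * z ^ 4)%C by ring.
    rewrite Cmod_mult, Cmod_R, Cmod_pow; lra.
  + now apply fatou_coordinate_attracting.
  + now apply fatou_coordinate_attracting.
  + now apply fatou_coordinate_attracting.
  + now apply fatou_parameterization_repelling.
  + now apply fatou_parameterization_repelling.
  + now apply fatou_parameterization_repelling.
  + reflexivity.
- exists c; split; [auto |]; split; [now rewrite EF |].
  apply is_derive_cderiv.
  assert (Dphi : cderiv (fatou_coordinate b) (RtoC c) 0).
  { apply fatou_coordinate_critical_point; auto.
    - rewrite RtoC_opp_inv by lra; simpl; pose proof (Rinv_0_lt_compat c); lra.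
    - replace (1 + 2 * RtoC c + 4 * RtoC b * RtoC c ^ 3)%C
        with (RtoC (1 + 2 * c + 4 * b * c ^ 3))
        by (rewrite !RtoC_plus, !RtoC_mult, RtoC_pow; reflexivity).
      now rewrite Crit. }
  destruct (fatou_parameterization_derivable b (fatou_coordinate b (RtoC c)) Hb) as [m Dpsi].
  pose proof (cderiv_comp _ _ _ _ _ Dphi Dpsi) as D.
  now replace (m * 0)%C with (RtoC 0) in D by ring.
Qed.
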